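(* Let $q\geq 3$ be odd. For every $x\in(0,1]$, \[ \operatorname*{w^*\text{-}lim}_{n\to\infty}\; x\log(n)\sum_{h\in W_{q,n}}|h'(x)|\,\delta_{h.x}=m, \] i.e. for every continuous $f\colon[0,1]\to\mathbb{R}$, $x\log(n)\sum_{h\in W_{q,n}}|h'(x)|f(h.x)\to\int_{[0,1]}f\,dm$ as $n\to\infty$.
   Context: Setup. Let $q\geq 3$ be odd and $\lambda=\lambda_q=2\cos(\pi/q)$. Elements of $\mathrm{PGL}_2(\mathbb{R})$ are written as matrices $\begin{bmatrix}a&b\\c&d\end{bmatrix}$ (a matrix and its nonzero scalar multiples represent the same element); they act on $\mathbb{R}\cup\{\infty\}$ by $x\mapsto (ax+b)/(cx+d)$, written $g.x$. The Hecke triangle group $\Gamma_q\subset\mathrm{PSL}_2(\mathbb{R})$ is generated by $T=\begin{bmatrix}1&\lambda\\0&1\end{bmatrix}$ and $S=\begin{bmatrix}0&1\\-1&0\end{bmatrix}$. Put $s(x)=\sin(x\pi/q)/\sin(\pi/q)$, $g_k=\begin{bmatrix}s(k)&-s(k+1)\\-s(k-1)&s(k)\end{bmatrix}\in\Gamma_q$ for $k\in\mathbb{Z}$, and $Q=\begin{bmatrix}0&1\\1&0\end{bmatrix}$. Let $K=\{(q+1)/2,\dots,q-1\}$. Let $\Lambda_q=\{g_k^{-1},(Qg_k)^{-1}:k\in K\}$; the semigroup in $\mathrm{PGL}_2(\mathbb{R})$ generated by $\Lambda_q$ is free, and $W_{q,n}$ denotes the set of its elements that are words of length $n$ over $\Lambda_q$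 (products of $n$ elements of $\Lambda_q$). For $h\in W_{q,n}$, $h'(x)$ denotes the derivative of $x\mapsto h.x$. $m$ is Lebesgue measure on $[0,1]$ and $\delta_y$ the Dirac measure at $y$. *)

(* Defs.v *)
From Stdlib Require Import Reals List ZArith Arith.
From Coquelicot Require Import Coquelicot.
Import ListNotations.
Open Scope R_scope.

(* A 2x2 real matrix [a b; c d], representing an element of PGL_2(R). *)
Record mat := Mat { ma : R; mb : R; mc : R; md : R }.

Definition mmul (g h : mat) : mat :=
  Mat (ma g * ma h + mb g * mc h) (ma g * mb h + mb g * md h)
      (mc g * ma h + md g * mc h) (mc g * mb h + md g * md h).

Definition mid : mat := Mat 1 0 0 1.

(* Inverse in PGL_2(R): the adjugate (a nonzero scalar multiple of the inverse). *)
Definition minv (g : mat) : mat := Mat (md g) (- mb g) (- mc g) (ma g).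

Definition act (g : mat) (x : R) : R := (ma g * x + mb g) / (mc g * x + md g).

(* lambda_q = 2 cos(pi/q), T, S generating the Hecke triangle group (context only). *)
Definition lam (q : nat) : R := 2 * cos (PI / INR q).
Definition Tq (q : nat) : mat := Mat 1 (lam q) 0 1.
Definition Sm : mat := Mat 0 1 (-1) 0.

Definition s (q : nat) (x : R) : R := sin (x * PI / INR q) / sin (PI / INR q).

Definition gk (q : nat) (k : Z) : mat :=
  Mat (s q (IZR k)) (- s q (IZR (k + 1))) (- s q (IZR (k - 1))) (s q (IZR k)).

Definition Qm : mat := Mat 0 1 1 0.

Definition Kset (q : nat) : list Z :=
  map Z.of_nat (seq ((q + 1) / 2) (q - 1 - (q + 1) / 2 + 1)).

Definition Lambda (q : nat) : list mat :=
  flat_map (fun k => [minv (gk q k); minv (mmul Qm (gk q k))]) (Kset q).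

Fixpoint words {A : Type} (L : list A) (n : nat) : list (list A) :=
  match n with
  | O => [nil]
  | S n' => flat_map (fun a => map (cons a) (words L n')) L
  end.

Definition word_prod (w : list mat) : mat := fold_right mmul mid w.

(* W_{q,n}: the elements of the (free) semigroup that are words of length n.
   By freeness, words and elements correspond bijectively. *)
Definition W (q n : nat) : list mat := map word_prod (words (Lambda q) n).

Definition sumR (l : list R) : R := fold_right Rplus 0 l.

Definition weighted_sum (q n : nat) (x : R) (f : R -> R) : R :=
  x * ln (INR n) *
  sumR (map (fun h => Rabs (Derive (act h) x) * f (act h x)) (W q n)).

Definition continuous_on_01 (f : R -> R) : Prop :=
  forall y, 0 <= y <= 1 ->
    filterlim f (within (fun z => 0 <= z <= 1) (locally y)) (locally (f y)).

(* Main.v *)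
Require Import Defs.
From Stdlib Require Import Reals List ZArith Arith Lra Lia Psatz.
From Stdlib Require Import ClassicalEpsilon FunctionalExtensionality.
From Coquelicot Require Import Coquelicot.
Open Scope R_scope.

(** The sum over words is the [n]-th iterate of the transfer operator [L] of an interval map
    with an indifferent fixed point at [0] and invariant density [1/x]. Hence
    [x L f(x) = P (y f(y)) (x)] for a Markov operator [P], whose weights telescope.

    [P] preserves increasing concave functions: replacing [v] by its tangent lines at the
    preimages of a point and summing by parts leaves a positive combination of explicit
    concave functions. So, if [v = y f(y)] is increasing and concave, [a_n = P^n v (1)] is
    decreasing.

    Splitting off the parabolic branch and integrating gives
    [int_0^1 f = int_0^{e_n} f + sum_{k<n} int_0^{e_{n-1-k}} L_1 L^k f], where
    [e_j = 1 / (1 + j lambda)] and [L_1] collects the other branches. By monotonicity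
    [L_1 L^k f (y)] lies between [lambda / (1 + lambda y)] times [P^k v (e_1)] and [a_k],
    and [a_k - P^k v (e_1) <= (1 + lambda) (a_k - a_{k+1})]. This is a renewal inequality
    with gaps [t_j = ln (1 + (j+1) lambda) - ln (1 + j lambda)]; since [a_n] decreases it
    forces [a_n ln n --> int_0^1 f]. Monotonicity carries the limit from [1] to [e_1],
    [e_2], ... and so to every [x]. The functions [c / max(y, c)] and their linear
    combinations are dense in the continuous functions, which gives the general case. *)

(** * Finite sums *)

Fixpoint psum (F : nat -> R) (n : nat) : R :=
  match n with O => 0 | S n => psum F n + F n end.

Lemma psum_ext (F G : nat -> R) (n : nat) :
  (forall i, (i < n)%nat -> F i = G i) -> psum F n = psum G n.
Proof.
  induction n as [|n IH]; intros H; simpl; [reflexivity|].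
  rewrite IH, H; auto with arith.
Qed.

Lemma psum_le (F G : nat -> R) (n : nat) :
  (forall i, (i < n)%nat -> F i <= G i) -> psum F n <= psum G n.
Proof.
  induction n as [|n IH]; intros H; simpl; [lra|].
  apply Rplus_le_compat; auto with arith.
Qed.

Lemma psum_plus (F G : nat -> R) (n : nat) :
  psum (fun i => F i + G i) n = psum F n + psum G n.
Proof. induction n as [|n IH]; simpl; [ring|rewrite IH; ring]. Qed.

Lemma psum_scal (c : R) (F : nat -> R) (n : nat) :
  psum (fun i => c * F i) n = c * psum F n.
Proof. induction n as [|n IH]; simpl; [ring|rewrite IH; ring]. Qed.

Lemma psum_telescope (F : nat -> R) (n : nat) :
  psum (fun i => F (S i) - F i) n = F n - F O.
Proof. induction n as [|n IH]; simpl; [ring|rewrite IH; ring]. Qed.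

Lemma psum_split (F : nat -> R) (m n : nat) :
  psum F (m + n) = psum F m + psum (fun i => F (m + i)%nat) n.
Proof.
  induction n as [|n IH]; simpl; [rewrite Nat.add_0_r; ring|].
  rewrite Nat.add_succ_r; simpl; rewrite IH; ring.
Qed.

Lemma psum_rev (F : nat -> R) (n : nat) :
  psum (fun i => F (n - 1 - i)%nat) n = psum F n.
Proof.
  induction n as [|n IH]; [reflexivity|].
  change (psum F (S n)) with (psum F n + F n). rewrite <- IH.
  change (S n) with (1 + n)%nat at 2. rewrite psum_split. simpl psum at 1.
  rewrite Rplus_0_l, Rplus_comm. f_equal.
  - apply psum_ext; intros i Hi; f_equal; lia.
  - f_equal; lia.
Qed.

(** * The sine sequence of the Hecke group *)

(** What the argument uses of [g k] = [s q k], with q = 2 p + 1 and [l] = [lam q]. [hs_det] says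
    that the matrices [gk] have determinant 1; [hs_mid] is the reflection of k into q - k at the
    middle. *)
Record hecke_seq (p : nat) (l : R) (g : nat -> R) : Prop := {
  hs_p : (1 <= p)%nat;
  hs_l : 0 < l <= 2;
  hs_pos : forall k, (p <= k <= 2 * p)%nat -> 0 < g k;
  hs_mid : g (S p) = g p;
  hs_rec : forall k, g (S (S k)) = l * g (S k) - g k;
  hs_det : forall k, g (S k) * g (S k) - g k * g (S (S k)) = 1;
  hs_last : g (2 * p)%nat = 1;
  hs_end : g (S (2 * p)) = 0 }.

Lemma sin_step (t u : R) : sin (t + u) + sin (t - u) = 2 * cos u * sin t.
Proof. rewrite sin_plus, sin_minus; ring. Qed.

(** The recursion is the sum formula [sin_step]. The determinant is the identity sin t ^ 2 - sin (t
    - u) sin (t + u) = sin u ^ 2. The values at the middle and at the end come from q u = PI and sin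
    (PI - t) = sin t. *)
Lemma hecke_seq_s (p : nat) : (1 <= p)%nat ->
  hecke_seq p (lam (2 * p + 1)) (fun k => s (2 * p + 1) (INR k)).
Proof.
  intros Hp. set (q := (2 * p + 1)%nat). unfold lam, s. set (u := PI / INR q).
  assert (HP : 1 <= INR p) by (apply (le_INR 1); exact Hp).
  assert (HQ : INR q = 2 * INR p + 1)
    by (unfold q; rewrite plus_INR, mult_INR; simpl; ring).
  assert (HQ0 : 0 < INR q) by lra.
  pose proof PI_RGT_0 as Hpi.
  assert (Hqu : INR q * u = PI) by (unfold u; field; lra).
  assert (Hu : 0 < u) by (apply Rdiv_lt_0_compat; lra).
  assert (Hu2 : 3 * u <= PI) by (rewrite <- Hqu; nra).
  assert (Hs : 0 < sin u) by (apply sin_gt_0; lra).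
  assert (E : forall x, x * PI / INR q = x * u) by (intros x; unfold u; field; lra).
  split.
  - exact Hp.
  - split; [|pose proof (COS_bound u); lra].
    apply Rmult_lt_0_compat; [lra|]. apply cos_gt_0; lra.
  - intros k [Hk1 Hk2]. rewrite E. apply Rdiv_lt_0_compat; [|exact Hs].
    apply le_INR in Hk1, Hk2. rewrite mult_INR in Hk2; simpl in Hk2.
    apply sin_gt_0; [apply Rmult_lt_0_compat; lra|].
    rewrite <- Hqu. apply Rmult_lt_compat_r; lra.
  - rewrite !E, S_INR. f_equal. rewrite <- sin_PI_x. f_equal. rewrite <- Hqu, HQ; ring.
  - intros k. rewrite !E, !S_INR.
    pose proof (sin_step ((INR k + 1) * u) u) as H.
    replace ((INR k + 1) * u + u) with ((INR k + 1 + 1) * u) in H by ring.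
    replace ((INR k + 1) * u - u) with (INR k * u) in H by ring.
    apply (Rmult_eq_reg_r (sin u)); [|lra]. field_simplify; [|lra|lra]. lra.
  - intros k. rewrite !E, !S_INR.
    set (t := (INR k + 1) * u).
    replace ((INR k + 1 + 1) * u) with (t + u) by (unfold t; ring).
    replace (INR k * u) with (t - u) by (unfold t; ring).
    assert (H : sin t * sin t - sin (t - u) * sin (t + u) = sin u * sin u).
    { rewrite sin_plus, sin_minus.
      pose proof (sin2_cos2 u) as H1; pose proof (sin2_cos2 t) as H2.
      unfold Rsqr in *.
      replace (cos u * cos u) with (1 - sin u * sin u) by lra.
      transitivity (sin t * sin t - (sin t * sin t * (cos u * cos u)
        - cos t * cos t * (sin u * sin u))); [ring|].
      replace (cos u * cos u) with (1 - sin u * sin u) by lra.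
      replace (cos t * cos t) with (1 - sin t * sin t) by lra. ring. }
    transitivity ((sin t * sin t - sin (t - u) * sin (t + u)) / (sin u * sin u)).
    + field; lra.
    + rewrite H; field; lra.
  - rewrite E. replace (sin (INR (2 * p) * u)) with (sin u); [field; lra|].
    rewrite <- sin_PI_x. f_equal. rewrite <- Hqu, HQ, mult_INR; simpl; ring.
  - rewrite E. replace (S (2 * p)) with q by (unfold q; lia).
    rewrite Hqu, sin_PI. unfold Rdiv; ring.
Qed.

(** * Inverse branches and the associated Markov operator *)

(* With [k = j + 1] and [g j = s j], the maps [brA j] and [brB j] below are [g_k^{-1}] and
   [(Q g_k)^{-1}]; the numerators are the next denominators. *)
Definition da (g : nat -> R) (j : nat) (x : R) : R := g j * x + g (S j).
Definition db (g : nat -> R) (j : nat) (x : R) : R := g j + g (S j) * x.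
Definition brA (g : nat -> R) (j : nat) (x : R) : R := da g (S j) x / da g j x.
Definition brB (g : nat -> R) (j : nat) (x : R) : R := db g (S j) x / db g j x.

Definition transfer (p : nat) (g : nat -> R) (f : R -> R) (x : R) : R :=
  psum (fun i => f (brA g (p + i) x) / (da g (p + i) x) ^ 2
               + f (brB g (p + i) x) / (db g (p + i) x) ^ 2) p.

(** The weight of the branch after conjugation by the density 1/x: [wA] times [brA] equals x / [da]
    ^ 2. *)
Definition wA (g : nat -> R) (j : nat) (x : R) : R := x / (da g j x * da g (S j) x).
Definition wB (g : nat -> R) (j : nat) (x : R) : R := x / (db g j x * db g (S j) x).

Definition markov (p : nat) (g : nat -> R) (v : R -> R) (x : R) : R :=
  psum (fun i => wA g (p + i) x * v (brA g (p + i) x)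
               + wB g (p + i) x * v (brB g (p + i) x)) p.

Section Branches.
Context (p : nat) (l : R) (g : nat -> R) (Hg : hecke_seq p l g).

Lemma hs_nonneg k : (p <= k <= S (2 * p))%nat -> 0 <= g k.
Proof.
  intros Hk. destruct (Nat.eq_dec k (S (2 * p))) as [->|].
  - rewrite (hs_end _ _ _ Hg); lra.
  - left; apply (hs_pos _ _ _ Hg); lia.
Qed.

(** [hs_det] makes [g] strictly log-concave, so once two neighbours are equal, as at [p], the
    sequence descends. *)
Lemma hs_decr k : (p <= k <= 2 * p)%nat -> g (S k) <= g k.
Proof.
  intros [H1 H2]. induction H1 as [|k Hk IH].
  - rewrite (hs_mid _ _ _ Hg); lra.
  - assert (D := hs_det _ _ _ Hg k).
    assert (0 < g k) by (apply (hs_pos _ _ _ Hg); lia).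
    assert (0 < g (S k)) by (apply (hs_pos _ _ _ Hg); lia).
    specialize (IH ltac:(lia)). nra.
Qed.

(** The recursion with l <= 2. It supplies the condition c <= 2 d of [kernel_supergradient] for the
    denominators [da]. *)
Lemma hs_double k : (p <= k < 2 * p)%nat -> g k <= 2 * g (S k).
Proof.
  intros Hk. pose proof (hs_rec _ _ _ Hg k). pose proof (hs_l _ _ _ Hg).
  assert (0 <= g (S (S k))) by (apply hs_nonneg; lia).
  assert (0 < g (S k)) by (apply (hs_pos _ _ _ Hg); lia). nra.
Qed.

Lemma hs_penult : g (2 * p - 1)%nat = l.
Proof.
  pose proof (hs_p _ _ _ Hg). pose proof (hs_rec _ _ _ Hg (2 * p - 1)) as E.
  replace (S (2 * p - 1)) with (2 * p)%nat in E by lia.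
  rewrite (hs_end _ _ _ Hg), (hs_last _ _ _ Hg) in E. lra.
Qed.

Lemma hs_cross k : g (S k) * g (S (S k)) - g k * g (S (S (S k))) = l.
Proof.
  rewrite (hs_rec _ _ _ Hg (S k)).
  transitivity (l * (g (S k) * g (S k) - g k * g (S (S k)))
    + (g (S k) * (g (S (S k)) - (l * g (S k) - g k)))); [ring|].
  rewrite (hs_det _ _ _ Hg k), (hs_rec _ _ _ Hg k); ring.
Qed.

Lemma da_pos j x : (p <= j < 2 * p)%nat -> 0 <= x -> 0 < da g j x.
Proof.
  intros Hj Hx. unfold da.
  assert (0 < g j) by (apply (hs_pos _ _ _ Hg); lia).
  assert (0 < g (S j)) by (apply (hs_pos _ _ _ Hg); lia). nra.
Qed.

Lemma da_pos' j x : (p <= j <= 2 * p)%nat -> 0 < x -> 0 < da g j x.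
Proof.
  intros Hj Hx. unfold da.
  assert (0 < g j) by (apply (hs_pos _ _ _ Hg); lia).
  assert (0 <= g (S j)) by (apply hs_nonneg; lia). nra.
Qed.

Lemma db_pos j x : (p <= j <= 2 * p)%nat -> 0 <= x -> 0 < db g j x.
Proof.
  intros Hj Hx. unfold db.
  assert (0 < g j) by (apply (hs_pos _ _ _ Hg); lia).
  assert (0 <= g (S j)) by (apply hs_nonneg; lia). nra.
Qed.

Lemma da_last x : da g (2 * p) x = x.
Proof. unfold da. rewrite (hs_last _ _ _ Hg), (hs_end _ _ _ Hg); ring. Qed.

Lemma db_last x : db g (2 * p) x = 1.
Proof. unfold db. rewrite (hs_last _ _ _ Hg), (hs_end _ _ _ Hg); ring. Qed.

Lemma da_rec j x : da g (S (S j)) x = l * da g (S j) x - da g j x.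
Proof. unfold da. rewrite !(hs_rec _ _ _ Hg); ring. Qed.

Lemma db_rec j x : db g (S (S j)) x = l * db g (S j) x - db g j x.
Proof. unfold db. rewrite !(hs_rec _ _ _ Hg); ring. Qed.

Lemma brA_unit j x : (p <= j < 2 * p)%nat -> 0 <= x <= 1 -> 0 <= brA g j x <= 1.
Proof.
  intros Hj Hx. assert (Ha := da_pos j x Hj (proj1 Hx)). unfold brA.
  assert (D1 := hs_decr j ltac:(lia)). assert (D2 := hs_decr (S j) ltac:(lia)).
  assert (0 <= g (S j)) by (apply hs_nonneg; lia).
  assert (0 <= g (S (S j))) by (apply hs_nonneg; lia).
  split; [apply Rdiv_le_0_compat; unfold da in *; nra|].
  apply Rle_div_l; [exact Ha|]. unfold da; nra.
Qed.

Lemma brA_pos j x : (p <= j < 2 * p)%nat -> 0 < x -> 0 < brA g j x.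
Proof.
  intros Hj Hx. apply Rdiv_lt_0_compat; [apply da_pos'|apply da_pos']; auto; lia.
Qed.

Lemma brB_unit j x : (p <= j < 2 * p)%nat -> 0 <= x <= 1 -> 0 < brB g j x <= 1.
Proof.
  intros Hj Hx. assert (Hb := db_pos j x ltac:(lia) (proj1 Hx)). unfold brB.
  assert (Hb' := db_pos (S j) x ltac:(lia) (proj1 Hx)).
  assert (D1 := hs_decr j ltac:(lia)). assert (D2 := hs_decr (S j) ltac:(lia)).
  split; [apply Rdiv_lt_0_compat; assumption|].
  apply Rle_div_l; [exact Hb|]. unfold db; nra.
Qed.

(** After cross-multiplication the determinant leaves 1 - x ^ 2 in the numerator. Together with
    [brB_le_brA] this arranges all preimages of x in one chain, as Abel summation requires. *)
Lemma brA_le_brB j x : (p <= j < 2 * p)%nat -> 0 <= x <= 1 -> brA g j x <= brB g j x.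
Proof.
  intros Hj Hx. assert (Ha := da_pos j x Hj (proj1 Hx)).
  assert (Hb := db_pos j x ltac:(lia) (proj1 Hx)).
  apply Rminus_le_0.
  replace (brB g j x - brA g j x) with ((1 - x ^ 2) / (da g j x * db g j x)).
  - apply Rdiv_le_0_compat; [nra|apply Rmult_lt_0_compat; assumption].
  - transitivity ((g (S j) * g (S j) - g j * g (S (S j))) * (1 - x ^ 2)
      / (da g j x * db g j x)).
    + rewrite (hs_det _ _ _ Hg j), Rmult_1_l; reflexivity.
    + unfold brA, brB, da, db in *; field; lra.
Qed.

Lemma brB_le_brA j x : (p <= j)%nat -> (S j < 2 * p)%nat -> 0 <= x <= 1 ->
  brB g (S j) x <= brA g j x.
Proof.
  intros Hj Hj' Hx. assert (Ha := da_pos j x ltac:(lia) (proj1 Hx)).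
  assert (Hb := db_pos (S j) x ltac:(lia) (proj1 Hx)).
  apply Rminus_le_0.
  replace (brA g j x - brB g (S j) x)
    with ((2 * x + l * x ^ 2) / (da g j x * db g (S j) x)).
  - pose proof (hs_l _ _ _ Hg).
    apply Rdiv_le_0_compat; [nra|apply Rmult_lt_0_compat; assumption].
  - transitivity (((g (S j) * g (S j) - g j * g (S (S j))
        + (g (S (S j)) * g (S (S j)) - g (S j) * g (S (S (S j))))) * x
        + (g (S j) * g (S (S j)) - g j * g (S (S (S j)))) * x ^ 2)
      / (da g j x * db g (S j) x)).
    + rewrite (hs_cross j), (hs_det _ _ _ Hg j), (hs_det _ _ _ Hg (S j)).
      replace (1 + 1) with 2 by ring; reflexivity.
    + unfold brA, brB, da, db in *; field; lra.
Qed.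

(** The next denominator in the recursion is nonnegative, so [da g j x] is at most l times
    [da g (S j) x]. The condition on [S j] excludes the parabolic branch, whose image reaches 0. *)
Lemma brA_ge j x : (p <= j)%nat -> (S j < 2 * p)%nat -> 0 <= x <= 1 ->
  / (1 + l) <= brA g j x.
Proof.
  intros Hj Hj' Hx. pose proof (hs_l _ _ _ Hg).
  assert (Ha := da_pos j x ltac:(lia) (proj1 Hx)). unfold brA.
  assert (Ha1 := da_pos (S j) x ltac:(lia) (proj1 Hx)).
  assert (0 <= da g (S (S j)) x).
  { unfold da. assert (0 <= g (S (S j))) by (apply hs_nonneg; lia).
    assert (0 <= g (S (S (S j)))) by (apply hs_nonneg; lia). nra. }
  rewrite da_rec in H0. apply Rle_div_r; [exact Ha|].
  apply (Rmult_le_reg_l (1 + l)); [lra|].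
  rewrite <- Rmult_assoc, Rinv_r; lra.
Qed.

Lemma brB_ge j x : (p <= j < 2 * p)%nat -> 0 <= x <= 1 -> / (1 + l) <= brB g j x.
Proof.
  intros Hj Hx. pose proof (hs_l _ _ _ Hg).
  assert (Hb := db_pos j x ltac:(lia) (proj1 Hx)). unfold brB.
  assert (Hb1 := db_pos (S j) x ltac:(lia) (proj1 Hx)).
  (* For the last index the recursion continues to the value -x, which is still at least -1; this
     case forces 1 + l in place of l. *)
  assert (- db g (S (S j)) x <= db g (S j) x).
  { destruct (Nat.eq_dec (S j) (2 * p)) as [E|].
    - rewrite db_rec. replace j with (2 * p - 1)%nat by lia.
      replace (S (2 * p - 1)) with (2 * p)%nat by lia.
      rewrite db_last. unfold db. replace (S (2 * p - 1)) with (2 * p)%nat by lia.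
      rewrite hs_penult, (hs_last _ _ _ Hg). lra.
    - pose proof (db_pos (S (S j)) x ltac:(lia) (proj1 Hx)); lra. }
  rewrite db_rec in H0. apply Rle_div_r; [exact Hb|].
  apply (Rmult_le_reg_l (1 + l)); [lra|].
  rewrite <- Rmult_assoc, Rinv_r; lra.
Qed.

(** The letter k = q - 1 gives the parabolic branch: in the coordinate 1/x it is the translation by
    l, and it fixes 0 with derivative 1. *)
Lemma brA_cusp x : brA g (2 * p - 1) x = x / (1 + l * x).
Proof.
  pose proof (hs_p _ _ _ Hg). unfold brA.
  replace (S (2 * p - 1)) with (2 * p)%nat by lia. rewrite da_last. f_equal.
  unfold da. replace (S (2 * p - 1)) with (2 * p)%nat by lia.
  rewrite hs_penult, (hs_last _ _ _ Hg); ring.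
Qed.

Lemma wA_cusp x : 0 < x -> wA g (2 * p - 1) x = / (1 + l * x).
Proof.
  intros Hx. pose proof (hs_p _ _ _ Hg). pose proof (hs_l _ _ _ Hg). unfold wA.
  replace (S (2 * p - 1)) with (2 * p)%nat by lia. rewrite da_last.
  unfold da. replace (S (2 * p - 1)) with (2 * p)%nat by lia.
  rewrite hs_penult, (hs_last _ _ _ Hg); field; nra.
Qed.

Lemma wA_pos j x : (p <= j < 2 * p)%nat -> 0 < x -> 0 < wA g j x.
Proof.
  intros Hj Hx. apply Rdiv_lt_0_compat; [exact Hx|].
  apply Rmult_lt_0_compat; apply da_pos'; auto; lia.
Qed.

Lemma wB_pos j x : (p <= j < 2 * p)%nat -> 0 < x -> 0 < wB g j x.
Proof.
  intros Hj Hx. apply Rdiv_lt_0_compat; [exact Hx|].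
  apply Rmult_lt_0_compat; apply db_pos; lra || lia.
Qed.

Lemma markov_transfer f x : 0 < x ->
  x * transfer p g f x = markov p g (fun y => y * f y) x.
Proof.
  intros Hx. unfold transfer, markov. rewrite <- psum_scal.
  apply psum_ext; intros i Hi.
  assert (0 < da g (p + i) x) by (apply da_pos'; auto; lia).
  assert (0 < da g (S (p + i)) x) by (apply da_pos'; auto; lia).
  assert (0 < db g (p + i) x) by (apply db_pos; lra || lia).
  assert (0 < db g (S (p + i)) x) by (apply db_pos; lra || lia).
  unfold wA, wB, brA, brB. field. lra.
Qed.

(** The endpoints of the branch images: [brB g j] sends 0 to [ratio j], and [brA g j] sends 0 to
    [ratio (S j)]. *)
Definition ratio (j : nat) : R := g (S j) / g j.
(* The tail sums of the weights, see [tail_wA] and [tail_wB]. *)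
Definition tail (r r' x : R) : R := x / (x + r) + / (1 + r' * x) - 1.

Lemma ratio_bound j : (p <= j <= 2 * p)%nat -> 0 <= ratio j <= 1.
Proof.
  intros Hj. assert (0 < g j) by (apply (hs_pos _ _ _ Hg); lia). unfold ratio.
  split; [apply Rdiv_le_0_compat; auto; apply hs_nonneg; lia|].
  apply Rle_div_l; [auto|]. rewrite Rmult_1_l. apply hs_decr; lia.
Qed.

Lemma ratio_decr j : (p <= j < 2 * p)%nat -> ratio (S j) <= ratio j.
Proof.
  intros Hj. assert (0 < g j) by (apply (hs_pos _ _ _ Hg); lia).
  assert (0 < g (S j)) by (apply (hs_pos _ _ _ Hg); lia). unfold ratio.
  pose proof (hs_det _ _ _ Hg j).
  apply Rle_div_l; [auto|].
  replace (g (S j) / g j * g (S j)) with ((g (S j) * g (S j)) / g j) by (field; lra).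
  apply Rle_div_r; [auto|]. nra.
Qed.

(** By the determinant, [wB g j x] is the difference of 1 / (1 + r x) at r = [ratio (S j)] and r =
    [ratio j]; in [tail_wA] the same happens with x / (x + r). So the weights telescope, from 0 at
    [p] to 1 at [2 * p]. *)
Lemma tail_wB j x : (p <= j < 2 * p)%nat -> 0 < x ->
  tail (ratio j) (ratio j) x + wB g j x = tail (ratio j) (ratio (S j)) x.
Proof.
  intros Hj Hx. assert (0 < g j) by (apply (hs_pos _ _ _ Hg); lia).
  assert (0 < g (S j)) by (apply (hs_pos _ _ _ Hg); lia).
  pose proof (db_pos j x ltac:(lia) ltac:(lra)) as B.
  pose proof (db_pos (S j) x ltac:(lia) ltac:(lra)) as B'.
  unfold tail, wB, ratio. unfold db in *.
  (* Writing the factor 1 as the determinant turns the claim into an identity of rational functions,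
     which [field] decides. *)
  replace (x / ((g j + g (S j) * x) * (g (S j) + g (S (S j)) * x)))
   with (x * (g (S j) * g (S j) - g j * g (S (S j)))
      / ((g j + g (S j) * x) * (g (S j) + g (S (S j)) * x)))
    by (rewrite (hs_det _ _ _ Hg j), Rmult_1_r; reflexivity).
  replace (/ (1 + g (S j) / g j * x)) with (g j / (g j + g (S j) * x))
    by (field; lra).
  replace (/ (1 + g (S (S j)) / g (S j) * x))
    with (g (S j) / (g (S j) + g (S (S j)) * x)) by (field; lra).
  unfold Rminus. rewrite !Rplus_assoc. f_equal. field. lra.
Qed.

Lemma tail_wA j x : (p <= j < 2 * p)%nat -> 0 < x ->
  tail (ratio j) (ratio (S j)) x + wA g j x = tail (ratio (S j)) (ratio (S j)) x.
Proof.
  intros Hj Hx. assert (0 < g j) by (apply (hs_pos _ _ _ Hg); lia).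
  assert (0 < g (S j)) by (apply (hs_pos _ _ _ Hg); lia).
  pose proof (da_pos' j x ltac:(lia) ltac:(lra)) as B.
  pose proof (da_pos' (S j) x ltac:(lia) ltac:(lra)) as B'.
  unfold tail, wA, ratio. unfold da in *.
  replace (x / ((g j * x + g (S j)) * (g (S j) * x + g (S (S j)))))
   with (x * (g (S j) * g (S j) - g j * g (S (S j)))
      / ((g j * x + g (S j)) * (g (S j) * x + g (S (S j)))))
    by (rewrite (hs_det _ _ _ Hg j), Rmult_1_r; reflexivity).
  replace (x / (x + g (S j) / g j)) with (g j * x / (g j * x + g (S j)))
    by (field; lra).
  replace (x / (x + g (S (S j)) / g (S j)))
    with (g (S j) * x / (g (S j) * x + g (S (S j)))) by (field; lra).
  set (z := / _). transitivity (z - 1 + (g j * x / (g j * x + g (S j)) +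
   x * (g (S j) * g (S j) - g j * g (S (S j))) /
   ((g j * x + g (S j)) * (g (S j) * x + g (S (S j)))))); [ring|].
  transitivity (z - 1 + g (S j) * x / (g (S j) * x + g (S (S j)))); [|ring].
  f_equal. field. lra.
Qed.

Lemma ratio_mid : ratio p = 1.
Proof.
  unfold ratio. rewrite (hs_mid _ _ _ Hg). apply Rinv_r.
  pose proof (hs_pos _ _ _ Hg p ltac:(lia)); lra.
Qed.

Lemma ratio_last : ratio (2 * p) = 0.
Proof. unfold ratio. rewrite (hs_end _ _ _ Hg). unfold Rdiv; ring. Qed.

Lemma tail_mid x : 0 < x -> tail (ratio p) (ratio p) x = 0.
Proof. intros Hx. rewrite ratio_mid. unfold tail. field. lra. Qed.

Lemma tail_last x : 0 < x -> tail (ratio (2 * p)) (ratio (2 * p)) x = 1.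
Proof. intros Hx. rewrite ratio_last. unfold tail. field. lra. Qed.

Lemma weights_sum n x : (n <= p)%nat -> 0 < x ->
  psum (fun i => wA g (p + i) x + wB g (p + i) x) n = tail (ratio (p + n)) (ratio (p + n)) x.
Proof.
  intros Hn Hx. induction n as [|n IH]; simpl.
  - rewrite Nat.add_0_r, tail_mid; auto.
  - rewrite IH, Nat.add_succ_r by lia.
    rewrite <- (tail_wA (p + n)), <- (tail_wB (p + n)) by (lia || auto). ring.
Qed.

(** The Markov property, equivalent to the invariance of the density 1/x under the transfer
    operator. *)
Lemma weights_sum_1 x : 0 < x -> psum (fun i => wA g (p + i) x + wB g (p + i) x) p = 1.
Proof.
  intros Hx. rewrite weights_sum by auto.
  replace (p + p)%nat with (2 * p)%nat by lia. apply tail_last; auto.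
Qed.

End Branches.

(** * Increasing concave functions *)

(** Allows one Abel summation to serve two classes of functions on (0,1]: those with a supergradient
    at a given point and those maximal at 1. *)
Record cone (G : (R -> R) -> Prop) : Prop := {
  cone_ext : forall f h, (forall x, 0 < x <= 1 -> f x = h x) -> G f -> G h;
  cone_const : forall c, G (fun _ => c);
  cone_plus : forall f h, G f -> G h -> G (fun x => f x + h x);
  cone_scal : forall c f, 0 <= c -> G f -> G (fun x => c * f x) }.

Lemma cone_psum (G : (R -> R) -> Prop) (F : nat -> R -> R) (n : nat) : cone G ->
  (forall i, (i < n)%nat -> G (F i)) -> G (fun x => psum (fun i => F i x) n).
Proof.
  intros HG. induction n as [|n IH]; intros H; simpl.
  - apply (cone_const _ HG).
  - apply (cone_plus _ HG); auto.
Qed.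

(** The slope may have either sign; nonnegativity is recovered later from maximality at 1. *)
Definition supergradient_at (y : R) (f : R -> R) : Prop :=
  exists m, forall x, 0 < x <= 1 -> f x <= f y + m * (x - y).

Definition max_at_1 (f : R -> R) : Prop := forall x, 0 < x <= 1 -> f x <= f 1.

Lemma cone_supergradient y : 0 < y <= 1 -> cone (supergradient_at y).
Proof.
  intros Hy. split.
  - intros f h E [m Hm]. exists m. intros x Hx. rewrite <- !E; auto.
  - intros c. exists 0. intros; lra.
  - intros f h [m Hm] [m' Hm']. exists (m + m'). intros x Hx.
    specialize (Hm x Hx); specialize (Hm' x Hx); lra.
  - intros c f Hc [m Hm]. exists (c * m). intros x Hx. specialize (Hm x Hx); nra.
Qed.

Lemma cone_max_at_1 : cone max_at_1.
Proof.
  split; unfold max_at_1.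
  - intros f h E H x Hx. rewrite <- (E x), <- (E 1); auto; lra.
  - intros c x _. apply Rle_refl.
  - intros f h Hf Hh x Hx. specialize (Hf x Hx); specialize (Hh x Hx); lra.
  - intros c f Hc H x Hx. apply Rmult_le_compat_l; auto.
Qed.

Lemma tail_supergradient y r r' : 0 < y <= 1 -> 0 <= r' <= r -> r <= 1 ->
  supergradient_at y (tail r r').
Proof.
  (* The slope is the derivative of [tail] at y. *)
  intros Hy Hr Hr1. exists (r / (y + r) ^ 2 - r' / (1 + r' * y) ^ 2). intros x Hx.
  unfold tail. apply Rminus_le_0.
  (* The summand x / (x + r) is concave and 1 / (1 + r' x) is convex. [K] compares their
     second-order remainders, both multiples of (x - y) ^ 2; it is the product of [K1] and [K2]. *)
  assert (K : r' * r' * ((x + r) * (y + r) ^ 2) <= r * ((1 + r' * x) * (1 + r' * y) ^ 2)).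
  { assert (K1 : r' * (y + r) <= r * (1 + r' * y)).
    { assert (0 <= r' * (1 - r) * (1 - y)) by (repeat apply Rmult_le_pos; lra). nra. }
    assert (K2 : r' * ((x + r) * (y + r)) <= (1 + r' * x) * (1 + r' * y)).
    { assert (r * r <= 1) by nra. assert (r' * (r * r) <= r') by nra.
      assert (0 <= r' * (1 - r) * (x + y)) by (repeat apply Rmult_le_pos; lra).
      assert (0 <= x * y <= 1) by nra.
      assert (r' * (x * y) <= 1) by nra.
      assert (0 <= (1 - r') * (1 - r' * (x * y))) by (apply Rmult_le_pos; lra).
      nra. }
    replace (r' * r' * ((x + r) * (y + r) ^ 2))
      with ((r' * (y + r)) * (r' * ((x + r) * (y + r)))) by ring.
    replace (r * ((1 + r' * x) * (1 + r' * y) ^ 2))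
      with ((r * (1 + r' * y)) * ((1 + r' * x) * (1 + r' * y))) by ring.
    apply Rmult_le_compat; auto; repeat apply Rmult_le_pos; lra. }
  assert (0 <= r' * x) by nra. assert (0 <= r' * y) by nra.
  match goal with |- 0 <= ?e =>
    replace e with ((x - y) ^ 2 *
      (r * ((1 + r' * x) * (1 + r' * y) ^ 2) - r' * r' * ((x + r) * (y + r) ^ 2))
      / ((x + r) * (y + r) ^ 2 * ((1 + r' * x) * (1 + r' * y) ^ 2)))
      by (field; lra) end.
  apply Rdiv_le_0_compat.
  - apply Rmult_le_pos; [apply pow2_ge_0|lra].
  - repeat apply Rmult_lt_0_compat; lra.
Qed.

Lemma tail_max_at_1 r r' : 0 <= r' <= r -> r <= 1 -> max_at_1 (tail r r').
Proof.
  intros Hr Hr1 x Hx. unfold tail. apply Rminus_le_0.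
  assert (0 <= r' * x) by nra.
  match goal with |- 0 <= ?e =>
    replace e with ((1 - x) * ((1 - r * r') * (r - r' * x))
      / ((1 + r) * (x + r) * ((1 + r' * x) * (1 + r')))) by (field; lra) end.
  apply Rdiv_le_0_compat.
  - repeat apply Rmult_le_pos; nra.
  - repeat apply Rmult_lt_0_compat; lra.
Qed.

(** The function x / (c x + d) ^ 2 is concave where c x <= 2 d, hence on (0,1], and the slope is its
    derivative at y. *)
Lemma kernel_supergradient c d y : 0 <= c <= 2 * d -> 0 < d -> 0 < y <= 1 ->
  forall x, 0 < x <= 1 ->
  x / (c * x + d) ^ 2 <= y / (c * y + d) ^ 2
    + (d - c * y) / (c * y + d) ^ 3 * (x - y).
Proof.
  intros Hc Hd Hy x Hx. apply Rminus_le_0.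
  assert (0 < c * x + d) by nra. assert (0 < c * y + d) by nra.
  match goal with |- 0 <= ?e =>
    replace e with ((x - y) ^ 2 * (c * (2 * d * d + c * d * x - c * c * x * y))
      / ((c * x + d) ^ 2 * (c * y + d) ^ 3)) by (field; lra) end.
  apply Rdiv_le_0_compat.
  - apply Rmult_le_pos; [apply pow2_ge_0|]. apply Rmult_le_pos; [lra|].
    assert (0 <= c * x * (d + d - c * y)) by (apply Rmult_le_pos; nra).
    assert (c * x <= 2 * d) by nra. nra.
  - apply Rmult_lt_0_compat; apply pow_lt; lra.
Qed.

(* Supergradients are required to be finite, also at the endpoint [1]. *)
Definition incr_concave (v : R -> R) : Prop :=
  forall y, 0 < y <= 1 ->
  exists m, 0 <= m /\ forall x, 0 < x <= 1 -> v x <= v y + m * (x - y).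

Lemma incr_concave_ext u v : (forall x, 0 < x <= 1 -> u x = v x) ->
  incr_concave u -> incr_concave v.
Proof.
  intros E Hu y Hy. destruct (Hu y Hy) as [m [Hm H]].
  exists m; split; auto. intros x Hx. rewrite <- !E; auto.
Qed.

Lemma incr_concave_le v x y : incr_concave v -> 0 < x -> x <= y -> y <= 1 -> v x <= v y.
Proof.
  intros Hv Hx Hxy Hy. destruct (Hv y) as [m [Hm H]]; [lra|].
  specialize (H x ltac:(lra)). nra.
Qed.

(** * Invariance of increasing concave functions under the Markov operator *)

Section Invariance.
Context (p : nat) (l : R) (g : nat -> R) (Hg : hecke_seq p l g).

Lemma brA_unit' j x : (p <= j < 2 * p)%nat -> 0 < x <= 1 -> 0 < brA g j x <= 1.
Proof.
  intros Hj Hx. split; [apply (brA_pos _ _ _ Hg); auto; lra|].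
  apply (brA_unit _ _ _ Hg); auto; lra.
Qed.

Lemma markov_le u v x : (forall y, 0 < y <= 1 -> u y <= v y) -> 0 < x <= 1 ->
  markov p g u x <= markov p g v x.
Proof.
  intros H Hx. apply psum_le; intros i Hi.
  pose proof (wA_pos _ _ _ Hg (p + i) x ltac:(lia) ltac:(lra)).
  pose proof (wB_pos _ _ _ Hg (p + i) x ltac:(lia) ltac:(lra)).
  pose proof (brA_unit' (p + i) x ltac:(lia) Hx).
  pose proof (brB_unit _ _ _ Hg (p + i) x ltac:(lia) ltac:(lra)).
  apply Rplus_le_compat; apply Rmult_le_compat_l; auto; lra.
Qed.

(* Abel summation: the branches are listed in decreasing order of their images, and the
   tail weights belong to the cone. *)
Lemma cone_weights (G : (R -> R) -> Prop) (eA eB : nat -> R) : cone G ->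
  (forall r r', 0 <= r' <= r -> r <= 1 -> G (tail r r')) ->
  (forall j, (p <= j < 2 * p)%nat -> eA j <= eB j) ->
  (forall j, (p <= j)%nat -> (S j < 2 * p)%nat -> eB (S j) <= eA j) ->
  G (fun x => psum (fun i => wA g (p + i) x * eA (p + i)%nat
                           + wB g (p + i) x * eB (p + i)%nat) p).
Proof.
  intros HG HT HAB HBA. pose proof (hs_p _ _ _ Hg) as Hp.
  (* [E] stands for the next value in the chain, and the [tail] is the total weight of the first n
     pairs. Each induction step adds two tails with nonnegative coefficients, the successive drops
     of the values. *)
  assert (K : forall n, (n <= p)%nat -> forall E,
    (forall j, (p <= j)%nat -> S j = (p + n)%nat -> E <= eA j) ->
    G (fun x => psum (fun i => wA g (p + i) x * eA (p + i)%nat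
                           + wB g (p + i) x * eB (p + i)%nat) n
         - E * tail (ratio g (p + n)) (ratio g (p + n)) x)).
  { induction n as [|n IH]; intros Hn E HE.
    - apply (cone_ext _ HG (fun _ => 0)); [|apply (cone_const _ HG)].
      intros x Hx; simpl. rewrite Nat.add_0_r, (tail_mid _ _ _ Hg) by lra; ring.
    - assert (R1 := ratio_bound _ _ _ Hg (p + n) ltac:(lia)).
      assert (R2 := ratio_bound _ _ _ Hg (S (p + n)) ltac:(lia)).
      assert (R3 := ratio_decr _ _ _ Hg (p + n) ltac:(lia)).
      assert (HE' : E <= eA (p + n)%nat) by (apply HE; lia).
      assert (HE2 := HAB (p + n)%nat ltac:(lia)).
      apply (cone_ext _ HG (fun x =>
        (psum (fun i => wA g (p + i) x * eA (p + i)%nat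
                      + wB g (p + i) x * eB (p + i)%nat) n
         - eB (p + n)%nat * tail (ratio g (p + n)) (ratio g (p + n)) x)
        + ((eB (p + n)%nat - eA (p + n)%nat)
             * tail (ratio g (p + n)) (ratio g (S (p + n))) x
           + (eA (p + n)%nat - E)
             * tail (ratio g (S (p + n))) (ratio g (S (p + n))) x))).
      + intros x Hx; simpl psum. rewrite Nat.add_succ_r.
        rewrite <- (tail_wA _ _ _ Hg (p + n)), <- (tail_wB _ _ _ Hg (p + n))
          by (lia || lra). ring.
      + apply (cone_plus _ HG); [|apply (cone_plus _ HG)].
        * apply IH; [lia|]. intros j Hj Hj'. rewrite <- Hj'. apply HBA; lia.
        * apply (cone_scal _ HG); [lra|]. apply HT; lra.
        * apply (cone_scal _ HG); [lra|]. apply HT; lra. }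
  (* The smallest value, on the parabolic branch; since the total weight is 1, the subtracted term
     is the constant [E]. *)
  set (E := eA (2 * p - 1)%nat).
  apply (cone_ext _ HG (fun x => (psum (fun i => wA g (p + i) x * eA (p + i)%nat
                           + wB g (p + i) x * eB (p + i)%nat) p
         - E * tail (ratio g (p + p)) (ratio g (p + p)) x) + E)).
  - intros x Hx. replace (p + p)%nat with (2 * p)%nat by lia.
    rewrite (tail_last _ _ _ Hg) by lra. ring.
  - apply (cone_plus _ HG); [|apply (cone_const _ HG)].
    apply K; [lia|]. intros j Hj Hj'. unfold E.
    replace (2 * p - 1)%nat with j by lia. lra.
Qed.

(* [markov v] with [v] replaced, on each branch, by its tangent line at the preimage of [y]
   (slopes [m]); the slope parts and the intercept parts are summed separately. *)
Definition tangent_image (v m : R -> R) (y x : R) : R :=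
  psum (fun i => m (brA g (p + i) y) * (x / da g (p + i) x ^ 2)
               + m (brB g (p + i) y) * (x / db g (p + i) x ^ 2)) p
  + psum (fun i =>
      wA g (p + i) x * (v (brA g (p + i) y) - m (brA g (p + i) y) * brA g (p + i) y)
    + wB g (p + i) x * (v (brB g (p + i) y) - m (brB g (p + i) y) * brB g (p + i) y)) p.

Lemma tangent_image_lines v m y x : 0 < x ->
  tangent_image v m y x =
  psum (fun i =>
      wA g (p + i) x * (v (brA g (p + i) y)
        + m (brA g (p + i) y) * (brA g (p + i) x - brA g (p + i) y))
    + wB g (p + i) x * (v (brB g (p + i) y)
        + m (brB g (p + i) y) * (brB g (p + i) x - brB g (p + i) y))) p.
Proof.
  intros Hx. unfold tangent_image. rewrite <- psum_plus. apply psum_ext; intros i Hi.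
  assert (HA : wA g (p + i) x * brA g (p + i) x = x / da g (p + i) x ^ 2).
  { pose proof (da_pos' _ _ _ Hg (p + i) x ltac:(lia) Hx).
    pose proof (da_pos' _ _ _ Hg (S (p + i)) x ltac:(lia) Hx).
    unfold wA, brA; field; lra. }
  assert (HB : wB g (p + i) x * brB g (p + i) x = x / db g (p + i) x ^ 2).
  { pose proof (db_pos _ _ _ Hg (p + i) x ltac:(lia) ltac:(lra)).
    pose proof (db_pos _ _ _ Hg (S (p + i)) x ltac:(lia) ltac:(lra)).
    unfold wB, brB; field; lra. }
  rewrite <- HA, <- HB; ring.
Qed.

Lemma tangent_image_eq v m y : 0 < y -> tangent_image v m y y = markov p g v y.
Proof.
  intros Hy. rewrite tangent_image_lines by auto. apply psum_ext; intros; ring.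
Qed.

Lemma markov_le_tangent_image v m y x :
  (forall y, 0 < y <= 1 -> forall x, 0 < x <= 1 -> v x <= v y + m y * (x - y)) ->
  0 < y <= 1 -> 0 < x <= 1 -> markov p g v x <= tangent_image v m y x.
Proof.
  intros Hm Hy Hx. rewrite tangent_image_lines by lra.
  apply psum_le; intros i Hi.
  pose proof (wA_pos _ _ _ Hg (p + i) x ltac:(lia) ltac:(lra)).
  pose proof (wB_pos _ _ _ Hg (p + i) x ltac:(lia) ltac:(lra)).
  pose proof (brA_unit' (p + i) x ltac:(lia) Hx).
  pose proof (brB_unit _ _ _ Hg (p + i) x ltac:(lia) ltac:(lra)).
  pose proof (brA_unit' (p + i) y ltac:(lia) Hy).
  pose proof (brB_unit _ _ _ Hg (p + i) y ltac:(lia) ltac:(lra)).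
  apply Rplus_le_compat; apply Rmult_le_compat_l; try lra; apply Hm; auto.
Qed.

(** Slopes of a concave function decrease, so the heights at 0 of its tangent lines increase with
    the point of contact. This is the monotonicity that [cone_weights] needs. *)
Lemma intercept_le v m y z :
  (forall y, 0 < y <= 1 -> forall x, 0 < x <= 1 -> v x <= v y + m y * (x - y)) ->
  0 < y -> y <= z -> z <= 1 -> v y - m y * y <= v z - m z * z.
Proof.
  intros Hm Hy Hyz Hz. destruct Hyz as [Hyz| ->]; [|lra].
  pose proof (Hm y ltac:(lra) z ltac:(lra)) as H1.
  pose proof (Hm z ltac:(lra) y ltac:(lra)) as H2.
  assert (m z <= m y) by nra. nra.
Qed.

(** [tangent_image] majorizes [markov p g v] and touches it at y, so a supergradient of the majorant
    at y is one of [markov p g v]. The slope part is a nonnegative combination of concave kernels;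
    the intercept part is handled by Abel summation. *)
Lemma incr_concave_markov v : incr_concave v -> incr_concave (markov p g v).
Proof.
  intros Hv.
  assert (Hm : exists m : R -> R, forall y, 0 < y <= 1 -> 0 <= m y /\
    forall x, 0 < x <= 1 -> v x <= v y + m y * (x - y)).
  { exists (fun y => epsilon (inhabits 0) (fun m => 0 <= m /\
      forall x, 0 < x <= 1 -> v x <= v y + m * (x - y))).
    intros y Hy. apply (epsilon_spec (inhabits 0) (fun m => 0 <= m /\
      forall x, 0 < x <= 1 -> v x <= v y + m * (x - y))). auto. }
  destruct Hm as [m Hm].
  assert (Hm0 : forall y, 0 < y <= 1 -> 0 <= m y) by (intros; apply Hm; auto).
  assert (Hm1 : forall y, 0 < y <= 1 -> forall x, 0 < x <= 1 ->
    v x <= v y + m y * (x - y)) by (intros y Hy; apply Hm; auto).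
  clear Hm.
  assert (HW : forall G y, cone G ->
    (forall r r', 0 <= r' <= r -> r <= 1 -> G (tail r r')) -> 0 < y <= 1 ->
    G (fun x => psum (fun i =>
      wA g (p + i) x * (v (brA g (p + i) y) - m (brA g (p + i) y) * brA g (p + i) y)
    + wB g (p + i) x * (v (brB g (p + i) y) - m (brB g (p + i) y) * brB g (p + i) y)) p)).
  { intros G y HG HT Hy.
    apply (cone_weights G (fun j => v (brA g j y) - m (brA g j y) * brA g j y)
                          (fun j => v (brB g j y) - m (brB g j y) * brB g j y));
      auto; intros; apply intercept_le; auto.
    - apply brA_unit'; auto.
    - apply (brA_le_brB _ _ _ Hg); auto; lra.
    - apply (brB_unit _ _ _ Hg); auto; lra.
    - apply (brB_unit _ _ _ Hg); auto; lia || lra.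
    - apply (brB_le_brA _ _ _ Hg); auto; lra.
    - apply brA_unit'; auto; lia. }
  assert (H1 : max_at_1 (markov p g v)).
  { intros x Hx. rewrite <- (tangent_image_eq v m 1) by lra.
    eapply Rle_trans; [apply (markov_le_tangent_image v m 1); auto; lra|].
    apply Rplus_le_compat.
    - apply psum_le; intros i Hi.
      (* At 1 the two branches of a pair have the same image, hence carry the same slope [m], and
         the derivatives of their kernels there are opposite and cancel. *)
      assert (E : brB g (p + i) 1 = brA g (p + i) 1).
      { unfold brA, brB, da, db. f_equal; [|f_equal]; ring. }
      rewrite E, <- !Rmult_plus_distr_l. apply Rmult_le_compat_l.
      { apply Hm0, brA_unit'; lra || lia. }
      assert (P1 := hs_pos _ _ _ Hg (p + i) ltac:(lia)).
      assert (P2 := hs_pos _ _ _ Hg (S (p + i)) ltac:(lia)).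
      assert (D1 := hs_decr _ _ _ Hg (p + i) ltac:(lia)).
      assert (D2 := hs_double _ _ _ Hg (p + i) ltac:(lia)).
      unfold da, db.
      pose proof (kernel_supergradient (g (p + i)%nat) (g (S (p + i))) 1
        ltac:(lra) P2 ltac:(lra) x Hx) as K1.
      pose proof (kernel_supergradient (g (S (p + i))) (g (p + i)%nat) 1
        ltac:(lra) P1 ltac:(lra) x Hx) as K2.
      rewrite (Rplus_comm _ (g (p + i)%nat)), (Rplus_comm _ (g (p + i)%nat)) in K2.
      replace ((g (p + i)%nat - g (S (p + i)) * 1) / (g (p + i)%nat + g (S (p + i)) * 1) ^ 3)
        with (- ((g (S (p + i)) - g (p + i)%nat * 1)
                 / (g (p + i)%nat * 1 + g (S (p + i))) ^ 3)) in K2 by (field; lra).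
      lra.
    - apply (HW max_at_1 1 cone_max_at_1 tail_max_at_1); lra. }
  intros y Hy. destruct (Req_dec y 1) as [->|Hy1].
  { exists 0. split; [lra|]. intros x Hx. rewrite Rmult_0_l, Rplus_0_r. auto. }
  assert (HS : supergradient_at y (tangent_image v m y)).
  { pose proof (cone_supergradient y Hy) as HG.
    apply (cone_plus _ HG).
    - apply (cone_psum _ (fun i x => m (brA g (p + i) y) * (x / da g (p + i) x ^ 2)
               + m (brB g (p + i) y) * (x / db g (p + i) x ^ 2)) p HG).
      intros i Hi.
      assert (P1 := hs_pos _ _ _ Hg (p + i) ltac:(lia)).
      assert (P2 := hs_pos _ _ _ Hg (S (p + i)) ltac:(lia)).
      assert (D1 := hs_decr _ _ _ Hg (p + i) ltac:(lia)).
      assert (D2 := hs_double _ _ _ Hg (p + i) ltac:(lia)).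
      apply (cone_plus _ HG); apply (cone_scal _ HG).
      + apply Hm0, brA_unit'; auto; lia.
      + eexists. intros x Hx. apply kernel_supergradient; auto; lra.
      + apply Hm0, (brB_unit _ _ _ Hg); lia || lra.
      + eexists. intros x Hx. unfold db.
        rewrite !(Rplus_comm (g (p + i)%nat)).
        apply kernel_supergradient; auto; lra.
    - apply (HW (supergradient_at y) y HG); auto.
      intros; apply tail_supergradient; auto. }
  destruct HS as [M HM]. exists M.
  assert (HM' : forall x, 0 < x <= 1 ->
    markov p g v x <= markov p g v y + M * (x - y)).
  { intros x Hx. rewrite <- (tangent_image_eq v m y) by lra.
    eapply Rle_trans; [apply (markov_le_tangent_image v m y)|apply HM]; auto. }
  (* Maximality at 1 together with y < 1 forces [M] to be nonnegative. *)
  split; [|exact HM'].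
  specialize (H1 y Hy). specialize (HM' 1 ltac:(lra)).
  assert (0 < 1 - y) by lra. nra.
Qed.
End Invariance.

(** * A renewal inequality *)

Lemma ln_le_sub1 x : 0 < x -> ln x <= x - 1.
Proof.
  intros Hx. pose proof (exp_ineq1_le (ln x)) as H. rewrite exp_ln in H by auto. lra.
Qed.

(** Minus the logarithm of the n-th image of 1 under the parabolic branch. Its increments [gap] are
    the renewal weights, by [RInt_cusp_kernel]. *)
Definition logsum (l : R) (n : nat) : R := ln (1 + INR n * l).
Definition gap (l : R) (n : nat) : R := logsum l (S n) - logsum l n.

Section Logsum.
Context (l : R) (Hl : 0 < l).

Lemma logsum_arg_pos n : 0 < 1 + INR n * l.
Proof. pose proof (pos_INR n). nra. Qed.

Lemma gap_eq n : gap l n = ln (1 + l / (1 + INR n * l)).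
Proof.
  pose proof (logsum_arg_pos n). pose proof (logsum_arg_pos (S n)).
  unfold gap, logsum. rewrite <- ln_div by auto. f_equal. rewrite S_INR. field. lra.
Qed.

Lemma gap_pos n : 0 <= gap l n.
Proof.
  pose proof (logsum_arg_pos n). rewrite gap_eq, <- ln_1.
  assert (0 <= l / (1 + INR n * l)) by (apply Rdiv_le_0_compat; lra).
  apply ln_le; lra.
Qed.

Lemma gap_decr m n : (m <= n)%nat -> gap l n <= gap l m.
Proof.
  intros Hmn. apply le_INR in Hmn. rewrite !gap_eq.
  pose proof (logsum_arg_pos n). pose proof (logsum_arg_pos m).
  assert (0 < l / (1 + INR n * l)) by (apply Rdiv_lt_0_compat; lra).
  apply ln_le; [lra|]. apply Rplus_le_compat_l.
  apply Rmult_le_compat_l; [lra|]. apply Rinv_le_contravar; [auto|]. nra.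
Qed.

Lemma gap_le_inv n : (1 <= n)%nat -> gap l n <= / INR n.
Proof.
  intros Hn. apply (le_INR 1) in Hn. simpl in Hn. rewrite gap_eq.
  pose proof (logsum_arg_pos n).
  assert (0 < l / (1 + INR n * l)) by (apply Rdiv_lt_0_compat; lra).
  eapply Rle_trans; [apply ln_le_sub1; lra|].
  replace (1 + l / (1 + INR n * l) - 1) with (l / (1 + INR n * l)) by ring.
  apply Rle_div_l; [auto|]. field_simplify; [|lra].
  apply Rle_div_r; lra.
Qed.

Lemma gap_lim : is_lim_seq (gap l) 0.
Proof.
  apply (is_lim_seq_le_le_loc (fun _ => 0) _ (fun n => / INR n)).
  - exists 1%nat. intros n Hn. split; [apply gap_pos|apply gap_le_inv; auto].
  - apply is_lim_seq_const.
  - apply (is_lim_seq_inv INR p_infty is_lim_seq_INR). discriminate.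
Qed.

Lemma logsum_psum n : psum (gap l) n = logsum l n.
Proof.
  unfold gap. rewrite psum_telescope. unfold logsum. simpl.
  rewrite Rmult_0_l, Rplus_0_r, ln_1. ring.
Qed.

Lemma logsum_incr m n : (m <= n)%nat -> logsum l m <= logsum l n.
Proof.
  intros Hmn. apply le_INR in Hmn. apply ln_le; [apply logsum_arg_pos|]. nra.
Qed.

Lemma logsum_lim : is_lim_seq (logsum l) p_infty.
Proof.
  unfold logsum.
  apply (filterlim_comp _ _ _ (fun n => 1 + INR n * l) ln _ (Rbar_locally p_infty)).
  - apply (is_lim_seq_plus _ _ 1 p_infty); [apply is_lim_seq_const| |reflexivity].
    apply (is_lim_seq_mult _ _ p_infty l p_infty); [apply is_lim_seq_INR|apply is_lim_seq_const|].
    apply is_Rbar_mult_p_infty_pos; exact Hl.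
  - apply is_lim_ln_p.
Qed.

Lemma logsum_nonneg n : 0 <= logsum l n.
Proof. rewrite <- logsum_psum. change 0 with (psum (gap l) 0).
  rewrite !logsum_psum. apply logsum_incr; lia. Qed.

Lemma ln_over_logsum : is_lim_seq (fun n => ln (INR n) / logsum l n) 1.
Proof.
  (* [ln n = logsum n - ln (l + 1/n)] *)
  apply is_lim_seq_ext_loc with (fun n => 1 - ln (l + / INR n) / logsum l n).
  - exists 1%nat. intros n Hn. apply (lt_INR 0) in Hn. simpl in Hn.
    assert (Hp : 0 < logsum l n).
    { unfold logsum. rewrite <- ln_1. apply ln_increasing; nra. }
    assert (E : logsum l n = ln (INR n) + ln (l + / INR n)).
    { unfold logsum. assert (0 < / INR n) by (apply Rinv_0_lt_compat; auto).
      rewrite <- ln_mult by lra. f_equal. field. lra. }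
    rewrite E in Hp |- *. field. lra.
  - replace (Finite 1) with (Finite (1 - 0)) by (f_equal; ring).
    apply is_lim_seq_minus'; [apply is_lim_seq_const|].
    apply (is_lim_seq_div (fun n => ln (l + / INR n)) _ (ln l) p_infty 0).
    + apply (is_lim_seq_continuous ln (fun n => l + / INR n) l).
      * apply derivable_continuous_pt. exists (/ l). apply derivable_pt_lim_ln; auto.
      * replace (Finite l) with (Finite (l + 0)) by (f_equal; ring).
        apply is_lim_seq_plus'; [apply is_lim_seq_const|].
        apply (is_lim_seq_inv INR p_infty is_lim_seq_INR). discriminate.
    + apply logsum_lim.
    + discriminate.
    + unfold is_Rbar_div, is_Rbar_mult; simpl. rewrite Rmult_0_r; reflexivity.
Qed.

End Logsum.

Lemma div2_lim : filterlim Nat.div2 eventually eventually.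
Proof.
  intros P [N HN]. exists (2 * N)%nat. intros n Hn. apply HN.
  rewrite Nat.div2_div. apply Nat.div_le_lower_bound; lia.
Qed.

Lemma cesaro_psum (a : nat -> R) : is_lim_seq a 0 ->
  is_lim_seq (fun n => psum a n / INR n) 0.
Proof.
  intros Ha. apply is_lim_seq_Reals in Ha. apply Cesaro_1, is_lim_seq_Reals in Ha.
  revert Ha. apply is_lim_seq_ext_loc. exists 1%nat. intros n Hn. f_equal.
  destruct n as [|n]; [lia|]. simpl Nat.pred. clear Hn.
  induction n as [|n IH]; simpl in *; [ring|rewrite IH; reflexivity].
Qed.

(* For a decreasing renewal sequence no Tauberian theorem is needed: [a n * logsum n] is
   trapped between the convolutions at [n] and at [2 * n]. *)
Lemma renewal_limit (l C J : R) (a b d : nat -> R) :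
  0 < l -> 0 <= C ->
  (forall n, 0 <= a n) -> (forall n, a (S n) <= a n) ->
  (forall n, a n - b n <= C * (a n - a (S n))) ->
  (forall n, psum (fun k => b k * gap l (n - 1 - k)) n <= J) ->
  (forall n, J - d n <= psum (fun k => a k * gap l (n - 1 - k)) n) ->
  is_lim_seq d 0 ->
  is_lim_seq (fun n => a n * logsum l n) J.
Proof.
  intros Hl HC Ha Hdec Hab Hup Hlo Hd.
  assert (Hmono : forall m n, (m <= n)%nat -> a n <= a m).
  { intros m n H; induction H; [lra|]. specialize (Hdec m0); lra. }
  pose proof (gap_pos l Hl) as Hg. pose proof (gap_decr l Hl) as Hgd.
  set (r := fun n => psum (fun k => (a k - a (S k)) * gap l (n - 1 - k)) n).
  (* The convolution is cut at m: before it the gaps are small, after it the decrements of [a] add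
     up to at most [a m]. *)
  assert (Hr : forall m n, (m <= n)%nat -> r n <= a O * gap l (n - m) + a m * gap l 0).
  { intros m n Hmn. unfold r. replace n with (m + (n - m))%nat at 1 by lia.
    assert (Tel : forall k q, psum (fun i => a (k + i)%nat - a (S (k + i))) q
                              = a k - a (k + q)%nat).
    { intros k q. induction q as [|q IH]; simpl; [rewrite Nat.add_0_r; ring|].
      rewrite IH, Nat.add_succ_r. ring. }
    rewrite psum_split. apply Rplus_le_compat.
    - apply Rle_trans with (psum (fun i => gap l (n - m) * (a (0 + i)%nat - a (S (0 + i)))) m).
      + apply psum_le; intros i Hi. rewrite Rmult_comm. simpl.
        apply Rmult_le_compat_r; [specialize (Hdec i); lra|]. apply Hgd; lia.
      + rewrite psum_scal, Tel. specialize (Ha (0 + m)%nat). specialize (Hg (n - m)%nat). nra.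
    - apply Rle_trans with (psum (fun i => gap l 0 * (a (m + i)%nat - a (S (m + i)))) (n - m)).
      + apply psum_le; intros i Hi. rewrite Rmult_comm.
        apply Rmult_le_compat_r; [specialize (Hdec (m + i)%nat); lra|]. apply Hgd; lia.
      + rewrite psum_scal, Tel. specialize (Ha (m + (n - m))%nat). specialize (Hg O). nra. }
  assert (Hconv : forall n, psum (fun k => a k * gap l (n - 1 - k)) n <= J + C * r n).
  { intros n. apply Rle_trans with (psum (fun k => b k * gap l (n - 1 - k)
      + C * ((a k - a (S k)) * gap l (n - 1 - k))) n).
    - apply psum_le; intros k _. specialize (Hab k). specialize (Hg (n - 1 - k)%nat). nra.
    - rewrite psum_plus, psum_scal. specialize (Hup n). unfold r; lra. }
  assert (Hrev : forall n, psum (fun k => gap l (n - 1 - k)) n = logsum l n).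
  { intros n. rewrite (psum_rev (gap l)), logsum_psum; auto. }
  assert (HaT : forall n, a n * logsum l n <= J + C * r n).
  { intros n. eapply Rle_trans; [|apply Hconv]. rewrite <- Hrev, <- psum_scal.
    apply psum_le; intros k Hk. apply Rmult_le_compat_r; auto. apply Hmono; lia. }
  (* Cutting at 0 only bounds [r], but this already gives a n = O(1 / logsum n). Knowing that [a]
     tends to 0, the cut at n / 2 then makes [r] tend to 0. *)
  assert (Ha0 : is_lim_seq a 0).
  { set (K := Rabs (J + C * (a O * gap l 0 + a O * gap l 0))).
    apply (is_lim_seq_le_le_loc (fun _ => 0) _ (fun n => K / logsum l n)).
    - exists 1%nat. intros n Hn. split; [auto|].
      assert (0 < logsum l n).
      { unfold logsum. rewrite <- ln_1. apply (lt_INR 0) in Hn. simpl in Hn.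
        apply ln_increasing; nra. }
      apply Rle_div_r; [auto|]. eapply Rle_trans; [apply HaT|].
      eapply Rle_trans; [|apply Rle_abs]. apply Rplus_le_compat_l, Rmult_le_compat_l; auto.
      eapply Rle_trans; [apply (Hr O); lia|]. apply Rplus_le_compat_r.
      apply Rmult_le_compat_l; auto. apply Hgd; lia.
    - apply is_lim_seq_const.
    - apply (is_lim_seq_div (fun _ => K) _ K p_infty 0).
      + apply is_lim_seq_const.
      + apply logsum_lim; auto.
      + discriminate.
      + unfold is_Rbar_div, is_Rbar_mult; simpl. rewrite Rmult_0_r; reflexivity. }
  apply (is_lim_seq_le_le_loc (fun n => J - d (2 * n)%nat - psum a n / INR n) _
    (fun n => J + C * (a O * gap l (Nat.div2 n) + a (Nat.div2 n) * gap l 0))).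
  - exists 1%nat. intros n Hn. split.
    + specialize (Hlo (2 * n)%nat). pose proof (gap_le_inv l Hl n Hn) as Hgi.
      (* Lower bound from the convolution at 2 n: in the first half every gap is at most 1 / n,
         leaving a Cesaro mean; in the second half every [a] is at most [a n]. *)
      assert (Hs : psum (fun k => a k * gap l (2 * n - 1 - k)) (n + n)
                   <= psum a n / INR n + a n * logsum l n).
      { rewrite psum_split. apply Rplus_le_compat.
        - unfold Rdiv. rewrite Rmult_comm, <- psum_scal. apply psum_le; intros i Hi.
          rewrite Rmult_comm. apply Rmult_le_compat_r; auto.
          eapply Rle_trans; [|apply Hgi]. apply Hgd; lia.
        - rewrite <- Hrev, <- psum_scal. apply psum_le; intros i Hi.
          replace (2 * n - 1 - (n + i))%nat with (n - 1 - i)%nat by lia.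
          apply Rmult_le_compat_r; auto. apply Hmono; lia. }
      replace (n + n)%nat with (2 * n)%nat in Hs by lia. lra.
    + eapply Rle_trans; [apply HaT|]. apply Rplus_le_compat_l, Rmult_le_compat_l; auto.
      assert (Hn2 : (2 * Nat.div2 n <= n)%nat).
      { rewrite Nat.div2_div. apply Nat.Div0.mul_div_le. }
      eapply Rle_trans; [apply (Hr (Nat.div2 n)); lia|]. apply Rplus_le_compat_r.
      apply Rmult_le_compat_l; auto. apply Hgd; lia.
  - replace (Finite J) with (Finite (J - 0 - 0)) by (f_equal; ring).
    apply is_lim_seq_minus'; [apply is_lim_seq_minus'; [apply is_lim_seq_const|]|].
    + apply (is_lim_seq_subseq d _ (fun n => (2 * n)%nat)); auto.
      intros P [N HN]. exists N. intros n Hn. apply HN; lia.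
    + apply cesaro_psum; auto.
  - replace (Finite J) with (Finite (J + C * (a O * 0 + 0 * gap l 0))) by (f_equal; ring).
    apply is_lim_seq_plus'; [apply is_lim_seq_const|].
    apply (is_lim_seq_scal_l _ C (a O * 0 + 0 * gap l 0)).
    apply is_lim_seq_plus'.
    + apply (is_lim_seq_scal_l _ (a O) 0).
      apply (is_lim_seq_subseq (gap l) _ Nat.div2 div2_lim). apply gap_lim; auto.
    + apply (is_lim_seq_scal_r _ (gap l 0) 0).
      apply (is_lim_seq_subseq a _ Nat.div2 div2_lim). auto.
Qed.

(** * Integration of the transfer operator *)

(** Two-sided continuity also at 0 and 1, stronger than [continuous_on_01]; the difference is
    bridged by [continuous_clamp]. *)
Definition continuous_at_01 (f : R -> R) : Prop := forall x, 0 <= x <= 1 -> continuous f x.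

(** Extending [f] continuously to the line makes its integral differentiable at the endpoints too.
    Changes of variable then become compositions with [F]. *)
Lemma antiderivative_01 (f : R -> R) : continuous_at_01 f ->
  exists F : R -> R, forall x, 0 <= x <= 1 -> is_derive F x (f x).
Proof.
  intros Hf. destruct (C0_extension_le f 0 1 Hf) as [h [Hh E]].
  exists (RInt h 0). intros x Hx. rewrite <- E by auto.
  apply is_derive_RInt with 0; [|apply Hh].
  apply filter_forall. intros y. apply (RInt_correct h), ex_RInt_continuous.
  intros z _; apply Hh.
Qed.

Lemma ex_RInt_01 (f : R -> R) (a b : R) : continuous_at_01 f ->
  0 <= a <= 1 -> 0 <= b <= 1 -> ex_RInt f a b.
Proof.
  intros Hf Ha Hb. apply (ex_RInt_continuous f). intros z Hz. apply Hf.
  revert Hz. apply Rmin_case; apply Rmax_case; lra.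
Qed.

Lemma RInt_derive_01 (F f : R -> R) (a b : R) : continuous_at_01 f ->
  (forall x, 0 <= x <= 1 -> is_derive F x (f x)) ->
  0 <= a <= 1 -> 0 <= b <= 1 -> RInt f a b = F b - F a.
Proof.
  intros Hf HF Ha Hb. apply is_RInt_unique. apply (is_RInt_derive F f);
    intros x Hx; [apply HF|apply Hf]; revert Hx; apply Rmin_case; apply Rmax_case; lra.
Qed.

Lemma continuous_psum (F : nat -> R -> R) (n : nat) (x : R) :
  (forall i, (i < n)%nat -> continuous (F i) x) ->
  continuous (fun y => psum (fun i => F i y) n) x.
Proof.
  induction n as [|n IH]; intros H; simpl; [apply continuous_const|].
  apply (continuous_plus (V := R_NormedModule)); auto.
Qed.

Lemma is_derive_psum (F : nat -> R -> R) (dF : nat -> R) (n : nat) (x : R) :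
  (forall i, (i < n)%nat -> is_derive (F i) x (dF i)) ->
  is_derive (fun y => psum (fun i => F i y) n) x (psum dF n).
Proof.
  induction n as [|n IH]; intros H; simpl; [apply is_derive_Reals, derivable_pt_lim_const|].
  apply (is_derive_plus (V := R_NormedModule)); auto.
Qed.

Section Integral.
Context (p : nat) (l : R) (g : nat -> R) (Hg : hecke_seq p l g).

Lemma is_derive_brA j x : (p <= j < 2 * p)%nat -> 0 <= x ->
  is_derive (brA g j) x (/ da g j x ^ 2).
Proof.
  intros Hj Hx. pose proof (da_pos _ _ _ Hg j x Hj Hx) as Hd.
  replace (/ da g j x ^ 2)
    with ((g (S j) * da g j x - da g (S j) x * g j) / da g j x ^ 2).
  - unfold brA, da in *. auto_derive; [lra|]. field; lra.
  - replace (g (S j) * da g j x - da g (S j) x * g j) with 1; [field; lra|].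
    rewrite <- (hs_det _ _ _ Hg j). unfold da; ring.
Qed.

Lemma is_derive_brB j x : (p <= j < 2 * p)%nat -> 0 <= x ->
  is_derive (brB g j) x (- / db g j x ^ 2).
Proof.
  intros Hj Hx. pose proof (db_pos _ _ _ Hg j x ltac:(lia) Hx) as Hd.
  replace (- / db g j x ^ 2)
    with ((g (S (S j)) * db g j x - db g (S j) x * g (S j)) / db g j x ^ 2).
  - unfold brB, db in *. auto_derive; [lra|]. field; lra.
  - replace (g (S (S j)) * db g j x - db g (S j) x * g (S j)) with (-(1)); [field; lra|].
    rewrite <- (hs_det _ _ _ Hg j). unfold db; ring.
Qed.

Lemma continuous_brA_term f j x : continuous_at_01 f -> (p <= j < 2 * p)%nat ->
  0 <= x <= 1 -> continuous (fun y => f (brA g j y) / da g j y ^ 2) x.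
Proof.
  intros Hf Hj Hx. pose proof (da_pos _ _ _ Hg j x Hj (proj1 Hx)) as Hd.
  apply (continuous_mult (fun y => f (brA g j y)) (fun y => / da g j y ^ 2)).
  - apply (continuous_comp (brA g j) f); [|apply Hf, (brA_unit _ _ _ Hg); auto].
    apply (ex_derive_continuous (V := R_NormedModule)). eexists. apply is_derive_brA; auto; lra.
  - apply (ex_derive_continuous (V := R_NormedModule)). unfold da in *. auto_derive. nra.
Qed.

Lemma continuous_brB_term f j x : continuous_at_01 f -> (p <= j < 2 * p)%nat ->
  0 <= x <= 1 -> continuous (fun y => f (brB g j y) / db g j y ^ 2) x.
Proof.
  intros Hf Hj Hx. pose proof (db_pos _ _ _ Hg j x ltac:(lia) (proj1 Hx)) as Hd.
  pose proof (brB_unit _ _ _ Hg j x Hj Hx).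
  apply (continuous_mult (fun y => f (brB g j y)) (fun y => / db g j y ^ 2)).
  - apply (continuous_comp (brB g j) f); [|apply Hf; lra].
    apply (ex_derive_continuous (V := R_NormedModule)). eexists. apply is_derive_brB; auto; lra.
  - apply (ex_derive_continuous (V := R_NormedModule)). unfold db in *. auto_derive. nra.
Qed.

Lemma continuous_transfer f : continuous_at_01 f -> continuous_at_01 (transfer p g f).
Proof.
  intros Hf x Hx.
  apply (continuous_psum (fun i x => f (brA g (p + i) x) / da g (p + i) x ^ 2
               + f (brB g (p + i) x) / db g (p + i) x ^ 2)).
  intros i Hi. apply (continuous_plus (V := R_NormedModule)).
  - apply continuous_brA_term; auto; lia.
  - apply continuous_brB_term; auto; lia.
Qed.

(** The branch images tile [0,1]. The antiderivative is the sum of F(brA) - F(brB), since [brB]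
    reverses orientation: at 1 each pair cancels, and at 0 the sum telescopes along [ratio] from 1
    down to 0. *)
Lemma RInt_transfer f : continuous_at_01 f -> RInt (transfer p g f) 0 1 = RInt f 0 1.
Proof.
  intros Hf. destruct (antiderivative_01 f Hf) as [F HF].
  rewrite (RInt_derive_01 F f) by (auto; lra).
  rewrite (RInt_derive_01
    (fun y => psum (fun i => F (brA g (p + i) y) - F (brB g (p + i) y)) p)).
  - rewrite (psum_ext _ (fun _ => 0 * 0)).
    2:{ intros i Hi. replace (brB g (p + i) 1) with (brA g (p + i) 1); [ring|].
        unfold brA, brB, da, db. f_equal; [|f_equal]; ring. }
    rewrite psum_scal, Rmult_0_l,
      (psum_ext _ (fun i => F (ratio g (p + S i)) - F (ratio g (p + i)))).
    2:{ intros i Hi. unfold brA, brB, da, db, ratio. rewrite Nat.add_succ_r.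
        rewrite !Rmult_0_r, !Rplus_0_l, !Rplus_0_r. reflexivity. }
    rewrite (psum_telescope (fun i => F (ratio g (p + i)))), Nat.add_0_r.
    rewrite (ratio_mid _ _ _ Hg). replace (p + p)%nat with (2 * p)%nat by lia.
    rewrite (ratio_last p l g Hg). lra.
  - apply continuous_transfer; auto.
  - intros x Hx.
    apply (is_derive_psum (fun i y => F (brA g (p + i) y) - F (brB g (p + i) y))).
    intros i Hi.
    pose proof (da_pos _ _ _ Hg (p + i) x ltac:(lia) (proj1 Hx)).
    pose proof (db_pos _ _ _ Hg (p + i) x ltac:(lia) (proj1 Hx)).
    replace (f (brA g (p + i) x) / da g (p + i) x ^ 2 + f (brB g (p + i) x) / db g (p + i) x ^ 2)
      with (minus (scal (/ da g (p + i) x ^ 2) (f (brA g (p + i) x)))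
             (scal (- / db g (p + i) x ^ 2) (f (brB g (p + i) x)))).
    2:{ unfold minus, plus, opp, scal; simpl. unfold mult; simpl. field; lra. }
    apply (is_derive_minus (V := R_NormedModule)).
    + apply (is_derive_comp F).
      * apply HF, (brA_unit _ _ _ Hg); auto; lia.
      * apply is_derive_brA; [lia|lra].
    + pose proof (brB_unit _ _ _ Hg (p + i) x ltac:(lia) Hx).
      apply (is_derive_comp F).
      * apply HF; lra.
      * apply is_derive_brB; [lia|lra].
  - lra.
  - lra.
Qed.

(** The operator L_1 of the introduction, written as a difference so that continuity and integrals
    reduce to those of [transfer]. *)
Definition noncusp (f : R -> R) (x : R) : R :=
  transfer p g f x - f (brA g (2 * p - 1) x) / da g (2 * p - 1) x ^ 2.

Lemma cusp_index : (p <= 2 * p - 1 < 2 * p)%nat.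
Proof. pose proof (hs_p _ _ _ Hg). lia. Qed.

Lemma continuous_noncusp f : continuous_at_01 f -> continuous_at_01 (noncusp f).
Proof.
  intros Hf x Hx. apply (continuous_minus (V := R_NormedModule)).
  - apply continuous_transfer; auto.
  - apply continuous_brA_term; auto using cusp_index.
Qed.

Lemma RInt_transfer_cusp f e : continuous_at_01 f -> 0 <= e <= 1 ->
  RInt (transfer p g f) 0 e = RInt f 0 (e / (1 + l * e)) + RInt (noncusp f) 0 e.
Proof.
  intros Hf He. pose proof cusp_index as Hc.
  destruct (antiderivative_01 f Hf) as [F HF].
  pose proof (brA_unit _ _ _ Hg _ e Hc He) as Hb.
  rewrite <- (brA_cusp _ _ _ Hg e).
  rewrite (RInt_derive_01 F f) by (auto; lra).
  set (h := fun x => f (brA g (2 * p - 1) x) / da g (2 * p - 1) x ^ 2).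
  assert (M : RInt (noncusp f) 0 e = RInt (transfer p g f) 0 e - RInt h 0 e).
  { apply (RInt_minus (V := R_CompleteNormedModule)); apply ex_RInt_01; try lra.
    - apply continuous_transfer; auto.
    - intros x Hx. apply continuous_brA_term; auto. }
  rewrite M. unfold h.
  rewrite (RInt_derive_01 (fun y => F (brA g (2 * p - 1) y))
    (fun x => f (brA g (2 * p - 1) x) / da g (2 * p - 1) x ^ 2)).
  - rewrite (brA_cusp _ _ _ Hg 0). replace (0 / (1 + l * 0)) with 0 by (field; lra).
    lra.
  - intros x Hx. apply continuous_brA_term; auto.
  - intros x Hx. pose proof (da_pos _ _ _ Hg _ x Hc (proj1 Hx)).
    replace (f (brA g (2 * p - 1) x) / da g (2 * p - 1) x ^ 2)
      with (scal (/ da g (2 * p - 1) x ^ 2) (f (brA g (2 * p - 1) x))).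
    2:{ apply Rmult_comm. }
    apply (is_derive_comp F).
    + apply HF, (brA_unit _ _ _ Hg); auto.
    + apply is_derive_brA; [lia|lra].
  - lra.
  - lra.
Qed.

(* All branches other than the cusp branch map into [1/(1+l), 1]. *)
Lemma markov_cusp_bounds v lo hi x : 0 < x <= 1 ->
  (forall y, / (1 + l) <= y <= 1 -> lo <= v y <= hi) ->
  (1 - / (1 + l * x)) * lo <= markov p g v x - / (1 + l * x) * v (x / (1 + l * x))
    <= (1 - / (1 + l * x)) * hi.
Proof.
  intros Hx Hv. pose proof cusp_index as Hc. pose proof (hs_p _ _ _ Hg) as Hp.
  rewrite <- (wA_cusp _ _ _ Hg x), <- (brA_cusp _ _ _ Hg x) by lra.
  (* The last pair is isolated: its branch [brA] is parabolic, while its branch [brB] still obeys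
     the bounds. *)
  set (n := (p - 1)%nat). replace (2 * p - 1)%nat with (p + n)%nat by lia.
  pose proof (weights_sum_1 _ _ _ Hg x (proj1 Hx)) as HW.
  assert (HS : forall F, psum F p = psum F n + F n).
  { intros F. replace p with (S n) by lia. reflexivity. }
  unfold markov. rewrite HS in HW |- *.
  assert (HB : forall i, (i <= n)%nat -> lo <= v (brB g (p + i) x) <= hi).
  { intros i Hi. apply Hv. split; [apply (brB_ge _ _ _ Hg); lia || lra|].
    apply (brB_unit _ _ _ Hg); lia || lra. }
  assert (HA : forall i, (i < n)%nat -> lo <= v (brA g (p + i) x) <= hi).
  { intros i Hi. apply Hv. split; [apply (brA_ge _ _ _ Hg); lia || lra|].
    apply (brA_unit _ _ _ Hg); lia || lra. }
  assert (WB := wB_pos _ _ _ Hg (p + n) x ltac:(lia) (proj1 Hx)).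
  assert (HBn := HB n (le_n n)).
  assert (E : 1 - wA g (p + n) x = psum (fun i => wA g (p + i) x + wB g (p + i) x) n
    + wB g (p + n) x) by lra.
  rewrite E.
  assert (L : lo * psum (fun i => wA g (p + i) x + wB g (p + i) x) n <=
    psum (fun i => wA g (p + i) x * v (brA g (p + i) x)
                 + wB g (p + i) x * v (brB g (p + i) x)) n
    <= hi * psum (fun i => wA g (p + i) x + wB g (p + i) x) n).
  { rewrite <- !psum_scal. split; apply psum_le; intros i Hi;
    assert (WA' := wA_pos _ _ _ Hg (p + i) x ltac:(lia) (proj1 Hx));
    assert (WB' := wB_pos _ _ _ Hg (p + i) x ltac:(lia) (proj1 Hx));
    specialize (HA i Hi); specialize (HB i ltac:(lia)); nra. }
  nra.
Qed.

(** [markov_cusp_bounds] divided by x, since 1 - 1 / (1 + l x) = x l / (1 + l x). *)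
Lemma noncusp_bounds f lo hi x : 0 < x <= 1 ->
  (forall y, / (1 + l) <= y <= 1 -> lo <= y * f y <= hi) ->
  l / (1 + l * x) * lo <= noncusp f x <= l / (1 + l * x) * hi.
Proof.
  intros Hx Hv. pose proof (hs_l _ _ _ Hg).
  pose proof (markov_cusp_bounds (fun y => y * f y) lo hi x Hx Hv) as H0.
  rewrite <- (markov_transfer _ _ _ Hg) in H0 by lra.
  assert (0 < 1 + l * x) by nra.
  replace (x * transfer p g f x - / (1 + l * x) * (x / (1 + l * x) * f (x / (1 + l * x))))
    with (x * noncusp f x) in H0.
  - replace (1 - / (1 + l * x)) with (x * (l / (1 + l * x))) in H0 by (field; lra).
    split; apply (Rmult_le_reg_l x); lra.
  - unfold noncusp. rewrite (brA_cusp _ _ _ Hg x).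
    pose proof cusp_index as Hc.
    unfold da. replace (S (2 * p - 1)) with (2 * p)%nat by lia.
    rewrite (hs_penult _ _ _ Hg), (hs_last _ _ _ Hg). field. nra.
Qed.

(** The orbit of 1 under the parabolic branch, e_j in the introduction. *)
Definition cusp_point (j : nat) : R := / (1 + INR j * l).

Lemma cusp_point_unit j : 0 < cusp_point j <= 1.
Proof.
  pose proof (hs_l _ _ _ Hg). pose proof (pos_INR j). unfold cusp_point.
  split; [apply Rinv_0_lt_compat; nra|].
  rewrite <- Rinv_1. apply Rinv_le_contravar; nra.
Qed.

Lemma cusp_point_0 : cusp_point 0 = 1.
Proof. unfold cusp_point. simpl. field. Qed.

Lemma cusp_point_S j : cusp_point j / (1 + l * cusp_point j) = cusp_point (S j).
Proof.
  pose proof (hs_l _ _ _ Hg). pose proof (pos_INR j).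
  unfold cusp_point. rewrite S_INR. field. split; nra.
Qed.

Lemma cusp_point_lim : is_lim_seq cusp_point 0.
Proof.
  pose proof (hs_l _ _ _ Hg). unfold cusp_point.
  apply (is_lim_seq_inv _ p_infty); [|discriminate].
  apply (is_lim_seq_plus _ _ 1 p_infty); [apply is_lim_seq_const| |reflexivity].
  apply (is_lim_seq_mult _ _ p_infty l p_infty); [apply is_lim_seq_INR|apply is_lim_seq_const|].
  apply is_Rbar_mult_p_infty_pos; simpl; lra.
Qed.

Lemma RInt_cusp_kernel j : is_RInt (fun y => l / (1 + l * y)) 0 (cusp_point j) (gap l j).
Proof.
  pose proof (hs_l _ _ _ Hg). pose proof (cusp_point_unit j).
  rewrite gap_eq by lra.
  replace (ln (1 + l / (1 + INR j * l)))
    with (minus (ln (1 + l * cusp_point j)) (ln (1 + l * 0))).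
  2:{ rewrite Rmult_0_r, Rplus_0_r, ln_1. unfold minus, plus, opp; simpl.
      rewrite Ropp_0, Rplus_0_r. reflexivity. }
  apply (is_RInt_derive (fun y => ln (1 + l * y)));
    intros x Hx; rewrite Rmin_left, Rmax_right in Hx by lra.
  - auto_derive; [nra|]. field. nra.
  - apply (ex_derive_continuous (V := R_NormedModule)). auto_derive. nra.
Qed.

Lemma RInt_noncusp_bounds f lo hi j : continuous_at_01 f ->
  (forall y, / (1 + l) <= y <= 1 -> lo <= y * f y <= hi) ->
  gap l j * lo <= RInt (noncusp f) 0 (cusp_point j) <= gap l j * hi.
Proof.
  intros Hf Hv. pose proof (cusp_point_unit j) as Hj.
  assert (K : forall c, is_RInt (fun y => l / (1 + l * y) * c) 0 (cusp_point j) (gap l j * c)).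
  { intros c. rewrite Rmult_comm.
    apply (is_RInt_ext (fun y => scal c (l / (1 + l * y)))).
    - intros; unfold scal; simpl; unfold mult; simpl; ring.
    - apply (is_RInt_scal (V := R_NormedModule)), RInt_cusp_kernel. }
  assert (X : ex_RInt (noncusp f) 0 (cusp_point j)).
  { apply ex_RInt_01; [apply continuous_noncusp; auto|lra|lra]. }
  rewrite <- (is_RInt_unique _ _ _ _ (K lo)), <- (is_RInt_unique _ _ _ _ (K hi)).
  split; apply RInt_le; auto; try lra; try (eexists; apply K);
    intros x Hx; apply (noncusp_bounds f lo hi x); auto; lra.
Qed.

(** * Iterates of the transfer operator and the renewal identity *)

Definition iterate (f : R -> R) (n : nat) : R -> R := Nat.iter n (transfer p g) f.

Lemma continuous_iterate f n : continuous_at_01 f -> continuous_at_01 (iterate f n).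
Proof. intros Hf. induction n; simpl; auto. apply continuous_transfer; auto. Qed.

Lemma transfer_le f h x : (forall y, 0 < y <= 1 -> f y <= h y) -> 0 < x <= 1 ->
  transfer p g f x <= transfer p g h x.
Proof.
  intros H Hx. apply (Rmult_le_reg_l x); [lra|].
  rewrite !(markov_transfer _ _ _ Hg) by lra.
  apply (markov_le _ _ _ Hg); auto. intros y Hy. apply Rmult_le_compat_l; auto; lra.
Qed.

Lemma iterate_le f h n x : (forall y, 0 < y <= 1 -> f y <= h y) -> 0 < x <= 1 ->
  iterate f n x <= iterate h n x.
Proof.
  intros H. revert x. induction n as [|n IH]; intros x Hx; simpl; auto.
  apply transfer_le; auto.
Qed.

Lemma transfer_lin f h a b x :
  transfer p g (fun y => a * f y + b * h y) x = a * transfer p g f x + b * transfer p g h x.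
Proof.
  unfold transfer. rewrite <- !psum_scal, <- psum_plus.
  apply psum_ext; intros; unfold Rdiv; ring.
Qed.

Lemma transfer_ext01 f h x : (forall y, 0 < y <= 1 -> f y = h y) -> 0 < x <= 1 ->
  transfer p g f x = transfer p g h x.
Proof.
  intros H Hx. apply Rle_antisym; apply transfer_le; auto; intros y Hy; rewrite H; auto; lra.
Qed.

Lemma iterate_lin f h a b n x : 0 < x <= 1 ->
  iterate (fun y => a * f y + b * h y) n x = a * iterate f n x + b * iterate h n x.
Proof.
  revert x. induction n as [|n IH]; intros x Hx; [reflexivity|].
  simpl. rewrite <- transfer_lin. apply transfer_ext01; auto.
Qed.

Lemma incr_concave_iterate f n : incr_concave (fun y => y * f y) ->
  incr_concave (fun y => y * iterate f n y).
Proof.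
  intros Hf. induction n as [|n IH]; simpl; auto.
  apply incr_concave_ext with (markov p g (fun y => y * iterate f n y)).
  - intros x Hx. rewrite (markov_transfer _ _ _ Hg); auto; lra.
  - apply (incr_concave_markov _ _ _ Hg); auto.
Qed.

Lemma RInt_iterate f n : continuous_at_01 f -> RInt (iterate f n) 0 1 = RInt f 0 1.
Proof.
  intros Hf. induction n as [|n IH]; [reflexivity|]. simpl. rewrite RInt_transfer; auto.
  apply continuous_iterate; auto.
Qed.

(** [RInt_transfer_cusp] applied n times: each step removes one iterate and moves the endpoint one
    step along the parabolic orbit. The index j is kept general for the induction. *)
Lemma renewal_identity f n j : continuous_at_01 f ->
  RInt (iterate f n) 0 (cusp_point j) = RInt f 0 (cusp_point (j + n))
   + psum (fun k => RInt (noncusp (iterate f k)) 0 (cusp_point (j + n - 1 - k))) n.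
Proof.
  intros Hf. revert j. induction n as [|n IH]; intros j.
  - simpl. rewrite Nat.add_0_r, Rplus_0_r. reflexivity.
  - pose proof (cusp_point_unit j). simpl iterate.
    rewrite RInt_transfer_cusp, cusp_point_S, IH by (lra || apply continuous_iterate; auto).
    simpl psum. rewrite <- Rplus_assoc. f_equal; [f_equal|].
    + f_equal; f_equal; lia.
    + apply psum_ext; intros k Hk. f_equal; f_equal; lia.
    + f_equal; f_equal; lia.
Qed.

(** * The limit when y f(y) is increasing and concave *)

Section Limit.
Context (f : R -> R) (Hf : continuous_at_01 f) (Hpos : forall x, 0 <= x <= 1 -> 0 <= f x)
  (Hv : incr_concave (fun y => y * f y)).

Let v (n : nat) (y : R) : R := y * iterate f n y.

Lemma iterate_incr n x y : 0 < x -> x <= y -> y <= 1 -> v n x <= v n y.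
Proof. apply incr_concave_le, incr_concave_iterate; auto. Qed.

Lemma iterate_S_markov n x : 0 < x -> v (S n) x = markov p g (v n) x.
Proof. intros Hx. unfold v. simpl. apply (markov_transfer _ _ _ Hg); auto. Qed.

Lemma iterate_nonneg n x : 0 < x <= 1 -> 0 <= v n x.
Proof.
  intros Hx. apply Rmult_le_pos; [lra|].
  (* The zero function in this form lets [iterate_lin] compute its iterate. *)
  assert (H : iterate (fun y => 0 * f y + 0 * f y) n x <= iterate f n x).
  { apply iterate_le; auto. intros y Hy. specialize (Hpos y ltac:(lra)); lra. }
  rewrite iterate_lin in H by auto. lra.
Qed.

(** The parabolic branch keeps its exact term; on all other branches the increasing function [v n]
    is bounded by its value at 1. *)
Lemma iterate_step n x : 0 < x <= 1 ->
  v (S n) x <= (1 - / (1 + l * x)) * v n 1 + / (1 + l * x) * v n (x / (1 + l * x)).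
Proof.
  intros Hx. pose proof (hs_l _ _ _ Hg).
  assert (H0 : 0 < / (1 + l)) by (apply Rinv_0_lt_compat; lra).
  pose proof (markov_cusp_bounds (v n) (v n (/ (1 + l))) (v n 1) x Hx) as B.
  rewrite iterate_S_markov by lra.
  destruct B as [_ B]; [|lra]. intros y Hy. split; apply iterate_incr; lra.
Qed.

Lemma iterate_limit_1 : is_lim_seq (fun n => v n 1 * logsum l n) (RInt f 0 1).
Proof.
  pose proof (hs_l _ _ _ Hg) as Hl.
  assert (Hc : 0 < / (1 + l)) by (apply Rinv_0_lt_compat; lra).
  assert (Hc1 : / (1 + l) <= 1) by (rewrite <- Rinv_1; apply Rinv_le_contravar; lra).
  assert (Hvle : forall n y, / (1 + l) <= y <= 1 -> v n (/ (1 + l)) <= v n y <= v n 1).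
  { intros n y Hy. split; apply iterate_incr; lra. }
  (* [iterate_step] at 1, where the parabolic branch has both weight and image 1 / (1 + l). This
     yields the constant C = 1 + l of [renewal_limit]. *)
  assert (HS : forall n, / (1 + l) * (v n 1 - v n (/ (1 + l))) <= v n 1 - v (S n) 1).
  { intros n. pose proof (iterate_step n 1 ltac:(lra)) as H. rewrite Rmult_1_r in H.
    replace (1 / (1 + l)) with (/ (1 + l)) in H by (field; lra). lra. }
  assert (Hren : forall n, RInt f 0 1 = RInt f 0 (cusp_point n)
   + psum (fun k => RInt (noncusp (iterate f k)) 0 (cusp_point (n - 1 - k))) n).
  { intros n. rewrite <- (RInt_iterate f n Hf), <- cusp_point_0 at 1.
    rewrite renewal_identity by auto. reflexivity. }
  apply (renewal_limit l (1 + l) _ _ (fun n => v n (/ (1 + l)))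
    (fun n => RInt f 0 (cusp_point n))); try lra.
  - intros n. apply iterate_nonneg; lra.
  - intros n. specialize (HS n). specialize (Hvle n 1 ltac:(lra)). nra.
  - intros n. specialize (HS n). apply (Rmult_le_compat_l (1 + l)) in HS; [|lra].
    rewrite <- Rmult_assoc, Rinv_r, Rmult_1_l in HS by lra. exact HS.
  - intros n. rewrite (Hren n).
    assert (0 <= RInt f 0 (cusp_point n)).
    { pose proof (cusp_point_unit n). apply RInt_ge_0; [lra| |].
      - apply ex_RInt_01; auto; lra.
      - intros x Hx. apply Hpos; lra. }
    eapply Rle_trans; [|apply (Rplus_le_compat_r _ _ _ H)]. rewrite Rplus_0_l.
    apply psum_le; intros k Hk. rewrite Rmult_comm.
    apply (RInt_noncusp_bounds _ _ (v k 1)); [apply continuous_iterate; auto|].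
    intros y Hy. apply (Hvle k y Hy).
  - intros n. rewrite (Hren n). unfold Rminus. rewrite Rplus_comm, <- Rplus_assoc.
    rewrite Rplus_opp_l, Rplus_0_l. apply psum_le; intros k Hk. rewrite Rmult_comm.
    apply (RInt_noncusp_bounds _ (v k (/ (1 + l)))); [apply continuous_iterate; auto|].
    intros y Hy. apply (Hvle k y Hy).
  - destruct (antiderivative_01 f Hf) as [F HF].
    apply is_lim_seq_ext with (fun n => F (cusp_point n) - F 0).
    { intros n. pose proof (cusp_point_unit n).
      rewrite (RInt_derive_01 F f); auto; lra. }
    replace (Finite 0) with (Finite (F 0 - F 0)) by (f_equal; ring).
    apply is_lim_seq_minus'; [|apply is_lim_seq_const].
    apply (is_lim_seq_continuous F cusp_point 0); [|apply cusp_point_lim].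
    apply continuity_pt_filterlim. apply (ex_derive_continuous F).
    eexists; apply HF; lra.
Qed.

Lemma logsum_shift (u : nat -> R) (J : R) :
  is_lim_seq (fun n => u n * logsum l n) J -> is_lim_seq (fun n => u (S n) * logsum l n) J.
Proof.
  intros Hu. pose proof (hs_l _ _ _ Hg) as Hl.
  apply is_lim_seq_ext with
    (fun n => (u (S n) * logsum l (S n)) * (1 - gap l n / logsum l (S n))).
  - intros n. assert (0 < logsum l (S n)).
    { unfold logsum. rewrite <- ln_1. pose proof (pos_INR n). rewrite S_INR.
      apply ln_increasing; nra. }
    unfold gap. field. lra.
  - replace (Finite J) with (Finite (J * (1 - 0))) by (f_equal; ring).
    apply is_lim_seq_mult'.
    + apply (is_lim_seq_incr_1 (fun n => u n * logsum l n)), Hu.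
    + apply is_lim_seq_minus'; [apply is_lim_seq_const|].
      apply (is_lim_seq_div _ _ 0 p_infty 0).
      * apply gap_lim; lra.
      * apply (is_lim_seq_incr_1 (logsum l)), logsum_lim; lra.
      * discriminate.
      * unfold is_Rbar_div, is_Rbar_mult; simpl. rewrite Rmult_0_r; reflexivity.
Qed.

(** Solving [iterate_step] at [cusp_point j] for the value at the next point bounds it below by a
    combination of known limits, with limit (J - (1 - w) J) / w = J. Monotonicity gives the upper
    bound [v n 1]. *)
Lemma iterate_limit_cusp_point j :
  is_lim_seq (fun n => v n (cusp_point j) * logsum l n) (RInt f 0 1).
Proof.
  pose proof (hs_l _ _ _ Hg) as Hl.
  induction j as [|j IH]; [rewrite cusp_point_0; apply iterate_limit_1|].
  pose proof (cusp_point_unit j) as Hj. pose proof (cusp_point_unit (S j)) as Hj'.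
  set (w := / (1 + l * cusp_point j)).
  assert (Hw : 0 < w) by (apply Rinv_0_lt_compat; nra).
  apply (is_lim_seq_le_le
    (fun n => / w * (v (S n) (cusp_point j) * logsum l n - (1 - w) * (v n 1 * logsum l n))) _
    (fun n => v n 1 * logsum l n)); [| |apply iterate_limit_1].
  - intros n. pose proof (logsum_nonneg l ltac:(lra) n) as HT.
    split; [|apply Rmult_le_compat_r; auto; apply iterate_incr; lra].
    pose proof (iterate_step n (cusp_point j) Hj) as B. fold w in B. rewrite cusp_point_S in B.
    apply (Rmult_le_reg_l w); [auto|]. rewrite <- Rmult_assoc, Rinv_r, Rmult_1_l by lra. nra.
  - replace (Finite (RInt f 0 1))
      with (Finite (/ w * (RInt f 0 1 - (1 - w) * RInt f 0 1))).
    2:{ apply (f_equal Finite). field. lra. }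
    apply (is_lim_seq_scal_l _ (/ w) (RInt f 0 1 - (1 - w) * RInt f 0 1)).
    apply is_lim_seq_minus'.
    + apply (logsum_shift (fun n => v n (cusp_point j))), IH.
    + apply (is_lim_seq_scal_l _ (1 - w) (RInt f 0 1)), iterate_limit_1.
Qed.

Lemma iterate_limit x : 0 < x <= 1 ->
  is_lim_seq (fun n => x * ln (INR n) * iterate f n x) (RInt f 0 1).
Proof.
  intros Hx. pose proof (hs_l _ _ _ Hg) as Hl.
  assert (Hlim : is_lim_seq (fun n => v n x * logsum l n) (RInt f 0 1)).
  (* Some cusp point lies below x, so [v n x] is squeezed between two values with the same limit. *)
  { destruct (cusp_point_lim (fun y => y < x)) as [j Hj].
    { apply (open_lt x). lra. }
    specialize (Hj j (le_n j)). pose proof (cusp_point_unit j).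
    apply (is_lim_seq_le_le (fun n => v n (cusp_point j) * logsum l n) _
      (fun n => v n 1 * logsum l n));
      [|apply iterate_limit_cusp_point|apply iterate_limit_1].
    intros n. pose proof (logsum_nonneg l ltac:(lra) n).
    split; apply Rmult_le_compat_r; auto; apply iterate_incr; lra. }
  apply is_lim_seq_ext_loc with
    (fun n => (v n x * logsum l n) * (ln (INR n) / logsum l n)).
  - exists 1%nat. intros n Hn. apply (lt_INR 0) in Hn. simpl in Hn.
    assert (0 < logsum l n) by (unfold logsum; rewrite <- ln_1; apply ln_increasing; nra).
    unfold v. field. lra.
  - replace (Finite (RInt f 0 1)) with (Finite (RInt f 0 1 * 1))
      by (apply (f_equal Finite); ring).
    apply is_lim_seq_mult'; [exact Hlim|]. apply ln_over_logsum; lra.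
Qed.

End Limit.
End Integral.

(** * Words and equidistribution *)

Lemma sumR_app u w : sumR (u ++ w) = sumR u + sumR w.
Proof. induction u as [|a u IH]; simpl; [ring|rewrite IH; ring]. Qed.

Lemma sumR_ext {X : Type} (F G : X -> R) (u : list X) :
  (forall a, In a u -> F a = G a) -> sumR (map F u) = sumR (map G u).
Proof.
  intros H. f_equal. apply map_ext_in. exact H.
Qed.

Lemma sumR_plus {X : Type} (F G : X -> R) (u : list X) :
  sumR (map (fun a => F a + G a) u) = sumR (map F u) + sumR (map G u).
Proof. induction u as [|a u IH]; simpl; [ring|rewrite IH; ring]. Qed.

Lemma sumR_scal {X : Type} (c : R) (F : X -> R) (u : list X) :
  sumR (map (fun a => c * F a) u) = c * sumR (map F u).
Proof. induction u as [|a u IH]; simpl; [ring|rewrite IH; ring]. Qed.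

Lemma sumR_flat_map {X Y : Type} (F : Y -> R) (h : X -> list Y) (u : list X) :
  sumR (map F (flat_map h u)) = sumR (map (fun a => sumR (map F (h a))) u).
Proof.
  induction u as [|a u IH]; simpl; [reflexivity|].
  rewrite map_app, sumR_app, IH; reflexivity.
Qed.

Lemma sumR_exchange {X Y : Type} (F : X -> Y -> R) (u : list X) (w : list Y) :
  sumR (map (fun a => sumR (map (F a) w)) u)
  = sumR (map (fun b => sumR (map (fun a => F a b) u)) w).
Proof.
  induction u as [|a u IH]; simpl.
  - rewrite (sumR_ext _ (fun _ => 0 * 0)) by (intros; ring).
    rewrite sumR_scal. ring.
  - rewrite IH, <- sumR_plus. reflexivity.
Qed.

Lemma sumR_seq (F : nat -> R) (m n : nat) :
  sumR (map F (seq m n)) = psum (fun i => F (m + i)%nat) n.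
Proof.
  induction n as [|n IH]; [reflexivity|].
  rewrite seq_S, map_app, sumR_app, IH. simpl. ring.
Qed.

Definition det (h : mat) : R := ma h * md h - mb h * mc h.

(* The condition [mc h * x + md h <> 0] rules out the junk value [y / 0 = 0] in [act]. *)
Definition unit_contraction (h : mat) : Prop :=
  Rabs (det h) = 1 /\
  forall x, 0 < x <= 1 -> mc h * x + md h <> 0 /\ 0 < act h x <= 1.

Lemma Derive_act h x : mc h * x + md h <> 0 ->
  Derive (act h) x = det h / (mc h * x + md h) ^ 2.
Proof.
  intros H. apply is_derive_unique. unfold act, det. auto_derive; [auto|]. field; auto.
Qed.

Lemma act_mmul a h x : mc h * x + md h <> 0 -> act (mmul a h) x = act a (act h x).
Proof.
  intros H. unfold act at 1 2. simpl.
  assert (E1 : (ma a * ma h + mb a * mc h) * x + (ma a * mb h + mb a * md h)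
    = (ma a * act h x + mb a) * (mc h * x + md h)) by (unfold act; field; auto).
  assert (E2 : (mc a * ma h + md a * mc h) * x + (mc a * mb h + md a * md h)
    = (mc a * act h x + md a) * (mc h * x + md h)) by (unfold act; field; auto).
  (* [Rinv_mult] carries no side condition; if the denominator of [a] vanishes, both sides are the
     default value 0. *)
  rewrite E1, E2. unfold Rdiv. rewrite Rinv_mult.
  rewrite Rmult_assoc. rewrite (Rmult_comm _ (/ (mc h * x + md h))).
  rewrite <- (Rmult_assoc (mc h * x + md h)), Rinv_r, Rmult_1_l; auto.
Qed.

Lemma unit_contraction_mmul a h : unit_contraction a -> unit_contraction h ->
  unit_contraction (mmul a h).
Proof.
  intros [Da Ha] [Dh Hh]. split.
  - replace (det (mmul a h)) with (det a * det h) by (unfold det; simpl; ring).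
    rewrite Rabs_mult, Da, Dh; ring.
  - intros x Hx. destruct (Hh x Hx) as [Nh Ih]. destruct (Ha _ Ih) as [Na Ia].
    rewrite act_mmul by auto. split; [|exact Ia]. simpl.
    replace ((mc a * ma h + md a * mc h) * x + (mc a * mb h + md a * md h))
      with ((mc a * act h x + md a) * (mc h * x + md h)) by (unfold act; field; auto).
    apply Rmult_integral_contrapositive_currified; auto.
Qed.

Lemma Rabs_Derive_act h x : unit_contraction h -> 0 < x <= 1 ->
  Rabs (Derive (act h) x) = / (mc h * x + md h) ^ 2.
Proof.
  intros [Dh Hh] Hx. destruct (Hh x Hx) as [Nh _].
  rewrite Derive_act by auto. unfold Rdiv. rewrite Rabs_mult, Dh, Rmult_1_l.
  apply Rabs_right, Rle_ge, Rlt_le, Rinv_0_lt_compat. rewrite <- Rsqr_pow2.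
  apply Rsqr_pos_lt; auto.
Qed.

Lemma Rabs_Derive_mmul a h x : unit_contraction a -> unit_contraction h -> 0 < x <= 1 ->
  Rabs (Derive (act (mmul a h)) x)
  = Rabs (Derive (act h) x) * Rabs (Derive (act a) (act h x)).
Proof.
  intros Ha Hh Hx. destruct (proj2 Hh x Hx) as [Nh Ih]. destruct (proj2 Ha _ Ih) as [Na _].
  rewrite !Rabs_Derive_act by auto using unit_contraction_mmul.
  rewrite <- Rinv_mult. f_equal. simpl mc; simpl md.
  replace ((mc a * ma h + md a * mc h) * x + (mc a * mb h + md a * md h))
    with ((mc a * act h x + md a) * (mc h * x + md h)) by (unfold act; field; auto).
  ring.
Qed.

Lemma words_unit_contraction (L : list mat) (n : nat) (w : list mat) :
  (forall a, In a L -> unit_contraction a) -> In w (words L n) ->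
  unit_contraction (word_prod w).
Proof.
  intros HL. revert w. induction n as [|n IH]; simpl; intros w Hw.
  - destruct Hw as [<-|[]]. split.
    { unfold det; simpl. replace (1 * 1 - 0 * 0) with 1 by ring. apply Rabs_R1. }
    intros x Hx. unfold act; simpl. split; [lra|].
    replace ((1 * x + 0) / (0 * x + 1)) with x by field. exact Hx.
  - apply in_flat_map in Hw as [a [Ha Hw]]. apply in_map_iff in Hw as [w' [<- Hw']].
    simpl. apply unit_contraction_mmul; auto.
Qed.

(** The head letter is the outermost factor, so it acts last. By the chain rule, summing over it
    first replaces [f] by its one-letter sum at the point [act h x]. *)
Lemma sumR_words_S (L : list mat) (n : nat) (f : R -> R) (x : R) :
  (forall a, In a L -> unit_contraction a) -> 0 < x <= 1 ->
  sumR (map (fun h => Rabs (Derive (act h) x) * f (act h x)) (map word_prod (words L (S n))))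
  = sumR (map (fun h => Rabs (Derive (act h) x)
      * sumR (map (fun a => Rabs (Derive (act a) (act h x)) * f (act a (act h x))) L))
      (map word_prod (words L n))).
Proof.
  intros HL Hx. rewrite !map_map. simpl words. rewrite sumR_flat_map.
  rewrite (sumR_ext _ (fun a => sumR (map (fun w =>
    Rabs (Derive (act (word_prod (a :: w))) x) * f (act (word_prod (a :: w)) x)) (words L n)))).
  2:{ intros a _. rewrite map_map. reflexivity. }
  rewrite (sumR_exchange (fun a w =>
    Rabs (Derive (act (word_prod (a :: w))) x) * f (act (word_prod (a :: w)) x))).
  apply sumR_ext; intros w Hw. rewrite <- sumR_scal.
  pose proof (words_unit_contraction L n w HL Hw) as HU.
  apply sumR_ext; intros a Ha. simpl.
  rewrite Rabs_Derive_mmul, act_mmul by (auto; apply (proj2 HU x Hx)). ring.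
Qed.

(** * The generators as inverse branches *)

Section Words.
Context (p : nat) (Hp : (1 <= p)%nat).
Let q := (2 * p + 1)%nat.
Let g (k : nat) : R := s q (INR k).
Let Hg : hecke_seq p (lam q) g := hecke_seq_s p Hp.

Lemma Kset_odd : Kset q = map Z.of_nat (seq (S p) p).
Proof.
  unfold Kset, q. replace ((2 * p + 1 + 1) / 2)%nat with (S p).
  - f_equal. f_equal. lia.
  - replace (2 * p + 1 + 1)%nat with (S p * 2)%nat by lia. rewrite Nat.div_mul; lia.
Qed.

Lemma gk_nat j : gk q (Z.of_nat (S j)) = Mat (g (S j)) (- g (S (S j))) (- g j) (g (S j)).
Proof.
  unfold gk, g. rewrite !INR_IZR_INZ.
  replace (Z.of_nat (S j) + 1)%Z with (Z.of_nat (S (S j))) by lia.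
  replace (Z.of_nat (S j) - 1)%Z with (Z.of_nat j) by lia. reflexivity.
Qed.

Lemma branchA_spec j : (p <= j < 2 * p)%nat ->
  unit_contraction (minv (gk q (Z.of_nat (S j)))) /\
  forall x, 0 < x <= 1 -> act (minv (gk q (Z.of_nat (S j)))) x = brA g j x /\
    Rabs (Derive (act (minv (gk q (Z.of_nat (S j))))) x) = / da g j x ^ 2.
Proof.
  intros Hj. rewrite gk_nat.
  assert (E : forall x, 0 < x <= 1 ->
    act (minv (Mat (g (S j)) (- g (S (S j))) (- g j) (g (S j)))) x = brA g j x).
  { intros x Hx. unfold act, brA, da; simpl. rewrite !Ropp_involutive. reflexivity. }
  assert (U : unit_contraction (minv (Mat (g (S j)) (- g (S (S j))) (- g j) (g (S j))))).
  { split.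
    - unfold det; simpl. rewrite <- Rabs_R1, <- (hs_det _ _ _ Hg j). f_equal; ring.
    - intros x Hx. rewrite E by auto. split; [|apply (brA_unit' _ _ _ Hg); auto].
      pose proof (da_pos _ _ _ Hg j x Hj ltac:(lra)). unfold da in *; simpl. lra. }
  split; [exact U|]. intros x Hx. split; [auto|]. rewrite Rabs_Derive_act by auto.
  unfold da; simpl. rewrite Ropp_involutive. reflexivity.
Qed.

Lemma branchB_spec j : (p <= j < 2 * p)%nat ->
  unit_contraction (minv (mmul Qm (gk q (Z.of_nat (S j))))) /\
  forall x, 0 < x <= 1 -> act (minv (mmul Qm (gk q (Z.of_nat (S j))))) x = brB g j x /\
    Rabs (Derive (act (minv (mmul Qm (gk q (Z.of_nat (S j)))))) x) = / db g j x ^ 2.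
Proof.
  intros Hj. rewrite gk_nat.
  set (h := minv _).
  (* The adjugate is minus the matrix of [brB]; the sign cancels in the action, and the determinant
     is -1. *)
  assert (Eh : h = Mat (- g (S (S j))) (- g (S j)) (- g (S j)) (- g j)).
  { unfold h, minv, mmul, Qm; simpl. f_equal; ring. }
  assert (E : forall x, 0 < x <= 1 -> act h x = brB g j x).
  { intros x Hx. pose proof (db_pos _ _ _ Hg j x ltac:(lia) ltac:(lra)) as B.
    rewrite Eh. unfold act, brB, db in *; simpl. field. lra. }
  assert (U : unit_contraction h).
  { split.
    - rewrite Eh. unfold det; simpl.
      rewrite <- Rabs_R1, <- (hs_det _ _ _ Hg j), <- Rabs_Ropp. f_equal; ring.
    - intros x Hx. rewrite E by auto.
      split; [|apply (brB_unit _ _ _ Hg); auto; lra].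
      pose proof (db_pos _ _ _ Hg j x ltac:(lia) ltac:(lra)).
      rewrite Eh. unfold db in *; simpl. lra. }
  split; [exact U|]. intros x Hx. split; [auto|]. rewrite Rabs_Derive_act by auto.
  f_equal. rewrite Eh. unfold db; simpl. ring.
Qed.

Lemma Lambda_unit_contraction a : In a (Lambda q) -> unit_contraction a.
Proof.
  unfold Lambda. rewrite Kset_odd. intros H.
  apply in_flat_map in H as [k [Hk Ha]]. apply in_map_iff in Hk as [j [<- Hj]].
  apply in_seq in Hj. destruct j as [|j]; [lia|].
  destruct Ha as [<-|[<-|[]]]; [apply branchA_spec|apply branchB_spec]; lia.
Qed.

Lemma sumR_Lambda f x : 0 < x <= 1 ->
  sumR (map (fun a => Rabs (Derive (act a) x) * f (act a x)) (Lambda q)) = transfer p g f x.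
Proof.
  intros Hx. unfold Lambda. rewrite Kset_odd, sumR_flat_map, map_map, sumR_seq.
  apply psum_ext; intros i Hi. change (S p + i)%nat with (S (p + i)).
  unfold sumR; cbn [map fold_right].
  destruct (branchA_spec (p + i) ltac:(lia)) as [_ HA].
  destruct (branchB_spec (p + i) ltac:(lia)) as [_ HB].
  destruct (HA x Hx) as [-> ->]. destruct (HB x Hx) as [-> ->].
  unfold Rdiv; ring.
Qed.

(** Induction over all [f], because removing the outermost letter changes [f] and leaves x fixed. *)
Lemma sumR_W f n x : 0 < x <= 1 ->
  sumR (map (fun h => Rabs (Derive (act h) x) * f (act h x)) (W q n)) = iterate p g f n x.
Proof.
  intros Hx. revert f. induction n as [|n IH]; intros f.
  - simpl. unfold word_prod; simpl.
    rewrite Derive_act by (simpl; lra). unfold act, det, mid; simpl.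
    replace ((1 * x + 0) / (0 * x + 1)) with x by field.
    replace ((1 * 1 - 0 * 0) / ((0 * x + 1) * ((0 * x + 1) * 1))) with 1 by field.
    rewrite Rabs_R1; ring.
  - unfold W. rewrite sumR_words_S by (auto using Lambda_unit_contraction).
    unfold iterate. rewrite Nat.iter_succ_r. fold (iterate p g (transfer p g f) n x).
    rewrite <- IH. apply sumR_ext; intros h Hh.
    apply in_map_iff in Hh as [w [<- Hw]].
    f_equal. apply sumR_Lambda.
    apply (words_unit_contraction _ _ _ Lambda_unit_contraction Hw); auto.
Qed.

(** * Test functions and their density *)

(** Chosen so that y times [cap c y] is min(y, c) for y > 0, which is increasing and concave. *)
Definition cap (c y : R) : R := c / Rmax y c.

Lemma cap_le c y : 0 < c -> y <= c -> cap c y = 1.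
Proof. intros Hc H. unfold cap. rewrite Rmax_right by auto. field; lra. Qed.

Lemma cap_ge c y : c <= y -> cap c y = c / y.
Proof. intros H. unfold cap. rewrite Rmax_left by auto. reflexivity. Qed.

Lemma continuous_cap c y : 0 < c -> continuous (cap c) y.
Proof.
  intros Hc. unfold cap.
  apply continuous_ext with (fun y => c * / ((y + c + Rabs (y - c)) / 2)).
  { intros z. unfold Rdiv at 2. f_equal. f_equal.
    unfold Rmax. destruct (Rle_dec z c); unfold Rabs; destruct (Rcase_abs (z - c)); lra. }
  apply (continuous_mult (fun _ => c)); [apply continuous_const|].
  apply (continuous_comp (fun y => (y + c + Rabs (y - c)) / 2) Rinv).
  - apply (continuous_mult _ (fun _ => / 2)); [|apply continuous_const].
    apply (continuous_plus (V := R_NormedModule)).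
    + apply (continuous_plus (V := R_NormedModule));
        [apply continuous_id|apply continuous_const].
    + apply continuous_Rabs_comp. apply (continuous_minus (V := R_NormedModule));
        [apply continuous_id|apply continuous_const].
  - apply continuous_Rinv. unfold Rabs; destruct (Rcase_abs (y - c)); lra.
Qed.

Lemma incr_concave_cap c : 0 < c -> incr_concave (fun y => y * cap c y).
Proof.
  intros Hc y Hy.
  assert (E : forall x, 0 < x -> x * cap c x = Rmin x c).
  { intros x Hx. destruct (Rle_lt_dec x c).
    - rewrite cap_le, Rmin_left by lra; ring.
    - rewrite cap_ge, Rmin_right by lra. field; lra. }
  exists (if Rlt_dec y c then 1 else 0). split; [destruct (Rlt_dec y c); lra|].
  intros x Hx. rewrite !E by lra.
  destruct (Rlt_dec y c).
  - rewrite (Rmin_left y) by lra. pose proof (Rmin_l x c); lra.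
  - rewrite (Rmin_right y) by lra. pose proof (Rmin_r x c); lra.
Qed.

Definition equidistributes (x : R) (f : R -> R) : Prop :=
  continuous_at_01 f /\
  is_lim_seq (fun n => x * ln (INR n) * iterate p g f n x) (RInt f 0 1).

Lemma equidistributes_lin x f h a b : 0 < x <= 1 ->
  equidistributes x f -> equidistributes x h ->
  equidistributes x (fun y => a * f y + b * h y).
Proof.
  intros Hx [Cf Lf] [Ch Lh]. split.
  - intros y Hy. apply (continuous_plus (V := R_NormedModule)).
    + apply (continuous_scal_r (V := R_NormedModule) a f); auto.
    + apply (continuous_scal_r (V := R_NormedModule) b h); auto.
  - replace (RInt (fun y => a * f y + b * h y) 0 1) with (a * RInt f 0 1 + b * RInt h 0 1).
    + apply is_lim_seq_ext with (fun n => a * (x * ln (INR n) * iterate p g f n x)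
        + b * (x * ln (INR n) * iterate p g h n x)).
      { intros n. rewrite (iterate_lin _ _ _ Hg) by auto. ring. }
      apply is_lim_seq_plus'.
      * apply (is_lim_seq_scal_l _ a (RInt f 0 1)); auto.
      * apply (is_lim_seq_scal_l _ b (RInt h 0 1)); auto.
    + symmetry. apply is_RInt_unique.
      apply (is_RInt_plus (V := R_NormedModule) (fun y => scal a (f y)) (fun y => scal b (h y)));
      apply (is_RInt_scal (V := R_NormedModule)), (RInt_correct (V := R_CompleteNormedModule)),
        ex_RInt_01; auto; lra.
Qed.

Lemma equidistributes_const x c : 0 < x <= 1 -> equidistributes x (fun _ => c).
Proof.
  intros Hx.
  assert (H1 : equidistributes x (fun _ => 1)).
  { split; [intros y _; apply continuous_const|].
    apply (iterate_limit _ _ _ Hg); auto.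
    - intros y _; apply continuous_const.
    - intros; lra.
    - intros y Hy. exists 1. split; [lra|]. intros; lra. }
  pose proof (equidistributes_lin x _ _ c 0 Hx H1 H1) as [C L].
  assert (E : (fun _ : R => c * 1 + 0 * 1) = (fun _ => c)).
  { apply functional_extensionality; intros; ring. }
  rewrite E in *. split; auto.
Qed.

Lemma equidistributes_cap x c : 0 < x <= 1 -> 0 < c -> equidistributes x (cap c).
Proof.
  intros Hx Hc. split; [intros y _; apply continuous_cap; auto|].
  apply (iterate_limit _ _ _ Hg); auto.
  - intros y _; apply continuous_cap; auto.
  - intros y Hy. unfold cap. apply Rdiv_le_0_compat; [lra|].
    pose proof (Rmax_r y c); lra.
  - apply incr_concave_cap; auto.
Qed.

Lemma ramp_exists x c d : 0 < x <= 1 -> 0 < c < d -> exists r, equidistributes x r /\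
  (forall y, y <= c -> r y = 0) /\ (forall y, d <= y -> r y = 1) /\
  (forall y, c <= y <= d -> 0 <= r y <= 1).
Proof.
  intros Hx Hcd.
  (* The coefficients make the constants cancel below c and the multiples of 1/y cancel above d. *)
  exists (fun y => 1 * (fun _ => 1) y
    + 1 * (fun y => c / (d - c) * cap d y + (- (d / (d - c))) * cap c y) y).
  split; [|split; [|split]].
  - apply equidistributes_lin; auto using equidistributes_const.
    apply equidistributes_lin; auto; apply equidistributes_cap; lra.
  - intros y Hy. rewrite !cap_le by lra. field; lra.
  - intros y Hy. rewrite !cap_ge by lra. field; lra.
  - intros y Hy. rewrite cap_le, cap_ge by lra.
    replace (1 * 1 + 1 * (c / (d - c) * 1 + - (d / (d - c)) * (c / y)))
      with (d * (y - c) / ((d - c) * y)) by (field; lra).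
    assert (0 < (d - c) * y) by nra.
    split; [apply Rdiv_le_0_compat; nra|]. apply Rle_div_l; nra.
Qed.

(** Interpolation of [f] on a uniform grid, built from left to right: the approximant is constant
    after the last node, and a ramp moves it to the next value. Between two nodes it lies between
    two values of [f] close to f y. *)
Lemma equidistributes_dense x f eps : 0 < x <= 1 -> continuous_at_01 f -> 0 < eps ->
  exists F, equidistributes x F /\ forall y, 0 <= y <= 1 -> Rabs (F y - f y) <= eps.
Proof.
  intros Hx Hf He.
  destruct (@Heine_cor2 f 0 1
    (fun y Hy => proj2 (continuity_pt_filterlim f y) (Hf y Hy)) (mkposreal eps He))
    as [[dl Hdl] HU]; simpl in HU.
  destruct (archimed_cor1 dl Hdl) as [N [HN HN0]].
  assert (HNR : 0 < INR N) by (apply (lt_INR 0); auto).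
  set (h := / INR N) in *. assert (Hh : 0 < h) by (apply Rinv_0_lt_compat; auto).
  assert (HNh : INR N * h = 1) by (apply Rinv_r; lra).
  assert (HU' : forall y z, 0 <= y <= 1 -> 0 <= z <= 1 -> y - h <= z <= y + h ->
    f y - eps <= f z <= f y + eps).
  { intros y z Hy Hz Hyz. specialize (HU z y Hz Hy ltac:(apply Rabs_def1; lra)).
    apply Rabs_def2 in HU. lra. }
  assert (K : forall i, (S i <= N)%nat -> exists F, equidistributes x F /\
    (forall y, 0 <= y <= INR (S i) * h -> Rabs (F y - f y) <= eps) /\
    (forall y, INR (S i) * h <= y -> F y = f (INR (S i) * h))).
  { induction i as [|i IH]; intros Hi.
    - exists (fun _ => f (INR 1 * h)). split; [apply equidistributes_const; auto|].
      split; [|auto]. intros y Hy. simpl in Hy |- *. rewrite Rmult_1_l in *.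
      apply le_INR in Hi. simpl in Hi.
      apply Rabs_le. specialize (HU' y h ltac:(nra) ltac:(nra) ltac:(lra)). lra.
    - destruct (IH ltac:(lia)) as [F [EF [F1 F2]]]. clear IH.
      set (c := INR (S i) * h) in *. set (d := INR (S (S i)) * h).
      assert (Hd : d = c + h) by (unfold d, c; rewrite (S_INR (S i)); ring).
      assert (Hc : 0 < c) by (apply Rmult_lt_0_compat; [apply (lt_INR 0); lia|auto]).
      assert (Hd1 : d <= 1).
      { unfold d. rewrite <- HNh. apply Rmult_le_compat_r; [lra|]. apply le_INR; auto. }
      destruct (ramp_exists x c d Hx ltac:(lra)) as [r [Er [r0 [r1 r01]]]].
      exists (fun y => 1 * F y + (f d - f c) * r y).
      split; [apply equidistributes_lin; auto|]. split.
      + intros y Hy. destruct (Rle_lt_dec y c) as [Hyc|Hyc].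
        * rewrite r0 by auto. replace (1 * F y + (f d - f c) * 0 - f y) with (F y - f y) by ring.
          apply F1; lra.
        * rewrite F2 by lra. specialize (r01 y ltac:(lra)).
          pose proof (HU' y c ltac:(lra) ltac:(lra) ltac:(lra)).
          pose proof (HU' y d ltac:(lra) ltac:(lra) ltac:(lra)).
          apply Rabs_le. nra.
      + intros y Hy. rewrite F2, r1 by lra. ring. }
  destruct N as [|N]; [lia|]. destruct (K N (le_n _)) as [F [EF [F1 _]]].
  exists F. split; auto. intros y Hy. apply F1. rewrite HNh. exact Hy.
Qed.

(** The iterates are monotone in the function, so they are trapped between those of F - eps/4 and F
    + eps/4. Comparing integrals costs eps/2 and convergence eps/4. *)
Lemma equidistributes_continuous x f : 0 < x <= 1 -> continuous_at_01 f ->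
  equidistributes x f.
Proof.
  intros Hx Hf. split; auto. apply is_lim_seq_spec. intros [eps He]; simpl.
  destruct (equidistributes_dense x f (eps / 4) Hx Hf ltac:(lra)) as [F [EF HF]].
  assert (Hc1 : equidistributes x (fun _ => 1)) by (apply equidistributes_const; auto).
  assert (HI : forall b, RInt (fun y => 1 * F y + b * 1) 0 1 = RInt F 0 1 + b).
  { intros b. destruct EF as [CF _]. apply is_RInt_unique.
    replace (RInt F 0 1 + b) with (plus (scal 1 (RInt F 0 1)) (scal (1 - 0) (b * 1))).
    2:{ unfold plus, scal; simpl. unfold mult; simpl. ring. }
    apply (is_RInt_plus (V := R_NormedModule) (fun y => scal 1 (F y))).
    - apply (is_RInt_scal (V := R_NormedModule)), (RInt_correct (V := R_CompleteNormedModule)).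
      apply ex_RInt_01; auto; lra.
    - apply (is_RInt_const (V := R_NormedModule)). }
  pose proof (equidistributes_lin x _ _ 1 (- (eps / 4)) Hx EF Hc1) as [C1 L1].
  pose proof (equidistributes_lin x _ _ 1 (eps / 4) Hx EF Hc1) as [C2 L2].
  assert (B1 : RInt F 0 1 + - (eps / 4) <= RInt f 0 1).
  { rewrite <- HI. apply RInt_le; [lra|apply ex_RInt_01; auto; lra|apply ex_RInt_01; auto; lra|].
    intros y Hy. specialize (HF y ltac:(lra)). apply Rabs_le_between in HF. lra. }
  assert (B2 : RInt f 0 1 <= RInt F 0 1 + eps / 4).
  { rewrite <- HI. apply RInt_le; [lra|apply ex_RInt_01; auto; lra|apply ex_RInt_01; auto; lra|].
    intros y Hy. specialize (HF y ltac:(lra)). apply Rabs_le_between in HF. lra. }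
  rewrite HI in L1, L2.
  apply is_lim_seq_spec in L1, L2.
  destruct (L1 (mkposreal (eps / 4) ltac:(lra))) as [N1 H1].
  destruct (L2 (mkposreal (eps / 4) ltac:(lra))) as [N2 H2]. simpl in H1, H2.
  exists (1 + N1 + N2)%nat. intros n Hn.
  specialize (H1 n ltac:(lia)). specialize (H2 n ltac:(lia)).
  apply Rabs_def2 in H1, H2.
  assert (Hln : 0 <= x * ln (INR n)).
  { apply Rmult_le_pos; [lra|]. rewrite <- ln_1. apply ln_le; [lra|].
    apply (le_INR 1); lia. }
  assert (I1 : iterate p g (fun y => 1 * F y + - (eps / 4) * 1) n x <= iterate p g f n x).
  { apply (iterate_le _ _ _ Hg); auto. intros y Hy. specialize (HF y ltac:(lra)).
    apply Rabs_le_between in HF. lra. }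
  assert (I2 : iterate p g f n x <= iterate p g (fun y => 1 * F y + eps / 4 * 1) n x).
  { apply (iterate_le _ _ _ Hg); auto. intros y Hy. specialize (HF y ltac:(lra)).
    apply Rabs_le_between in HF. lra. }
  apply (Rmult_le_compat_l _ _ _ Hln) in I1, I2.
  apply Rabs_def1; lra.
Qed.

End Words.

(** * Passage to functions continuous on [0,1] *)

(** The clamp onto [0,1] is 1-Lipschitz with values in [0,1], so continuity relative to the interval
    suffices. *)
Lemma continuous_clamp (f : R -> R) (y : R) : continuous_on_01 f ->
  continuous (fun z => f (Rmax 0 (Rmin 1 z))) y.
Proof.
  intros Hf. set (cl := fun z => Rmax 0 (Rmin 1 z)).
  assert (Hcl : forall z, 0 <= cl z <= 1).
  { intros z. unfold cl. split; [apply Rmax_l|]. apply Rmax_lub; [lra|apply Rmin_l]. }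
  assert (Hlip : forall z, Rabs (cl z - cl y) <= Rabs (z - y)).
  { intros z. unfold cl, Rmax, Rmin.
    destruct (Rle_dec 1 z), (Rle_dec 1 y); repeat destruct Rle_dec;
      unfold Rabs; repeat destruct Rcase_abs; lra. }
  specialize (Hf (cl y) (Hcl y)). unfold continuous.
  apply (filterlim_comp _ _ _ cl f _ (within (fun z => 0 <= z <= 1) (locally (cl y)))); auto.
  intros P [e He]. exists e. intros z Hz. apply He; auto.
  eapply Rle_lt_trans; [apply Hlip|exact Hz].
Qed.

Theorem theorem1p2 (q : nat) (hq : (3 <= q)%nat) (hodd : Nat.Odd q)
  (x : R) (hx : 0 < x <= 1) :
  forall f : R -> R, continuous_on_01 f ->
    is_lim_seq (fun n : nat => weighted_sum q n x f) (RInt f 0 1).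
Proof.
  intros f Hf. destruct hodd as [p ->]. assert (Hp : (1 <= p)%nat) by lia.
  set (h := fun z => f (Rmax 0 (Rmin 1 z))).
  assert (E : forall y, 0 <= y <= 1 -> f y = h y).
  { intros y Hy. unfold h. rewrite Rmin_right, Rmax_right by lra. reflexivity. }
  destruct (equidistributes_continuous p Hp x h hx) as [_ L].
  { intros y _. apply continuous_clamp; auto. }
  replace (RInt f 0 1) with (RInt h 0 1).
  2:{ symmetry. apply (RInt_ext (V := R_CompleteNormedModule)).
      rewrite Rmin_left, Rmax_right by lra. intros; apply E; lra. }
  revert L. apply is_lim_seq_ext. intros n. unfold weighted_sum.
  rewrite sumR_W by auto. f_equal.
  (* The iterates at x depend only on values on (0,1], where [f] and its clamped version agree. *)
  apply Rle_antisym; apply (iterate_le _ _ _ (hecke_seq_s p Hp)); auto;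
    intros y Hy; rewrite E by lra; lra.
Qed.
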